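(* Let $N\ge 1$ and let $\mathcal{G}$ be an $N$-petal flower in which each petal may independently be twisted or untwisted. Then the number of faces (boundary components) $F(\mathcal{G})$ of $\mathcal{G}$ is either $1$ or $2$.
   Context: A ribbon graph is a surface with boundary (not necessarily orientable) presented as a union of closed discs called vertices and edges, such that vertices and edges intersect in disjoint line segments, each such segment lies on the boundary of exactly one vertex and one edge, and every edge contains exactly two such segments. A self-loop is an edge whose two ends are attached to the same vertex $v$; it is twisted if $v\cup e$ is a Möbius band and untwisted if $v\cup e$ is an annulus. The faces of a ribbon graph are the connected components of the boundary of the surface. An $N$-petal flower is a ribbon graph with a single vertex and $N$ self-loops (petals) $e_1,\dots,e_N$, where $e_i$ has ends $a_i,b_i$ attached around the vertex boundary in the cyclic order $a_1,a_2,b_1,a_3,b_2,a_4,b_3,\dots,a_N,b_{N-1},b_N$; thus the ends of $e_i$ and $e_{i+1}$ alternate in the cyclic order for each $i$, while the ends of $e_i$ and $e_j$ do not alternate when $|i-j|\ge 2$. Each petal may be twisted or untwisted. *)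

(* Defs.v *)
From HB Require Import structures.
From mathcomp Require Import all_boot all_order all_algebra.
From mathcomp Require Import all_classical all_reals all_analysis.

Set Implicit Arguments.
Unset Strict Implicit.
Unset Printing Implicit Defensive.

Import Order.TTheory GRing.Theory Num.Theory.
Import numFieldNormedType.Exports.

Local Open Scope classical_set_scope.
Local Open Scope ring_scope.

(* [f] restricts to a homeomorphism from the subspace [A] onto the subspace
   [B]; the values of [f] and [g] off [A] and [B] are irrelevant. *)
Definition homeo_between (S T : topologicalType) (A : set S) (B : set T)
    (f : S -> T) : Prop :=
  [/\ set_bij A B f, {within A, continuous f} &
      exists g : T -> S, {in A, cancel f g} /\ {within B, continuous g}].

Section Surfaces.
Variables (R : realType) (T : topologicalType).

Definition half_plane : set (R * R) := [set p | 0 <= p.2].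

(* [x] has an open neighbourhood homeomorphic to a relatively open subset of
   [H]. *)
Definition has_chart_in (H : set (R * R)) (x : T) : Prop :=
  exists (U : set T) (W : set (R * R)) (f : T -> R * R),
    [/\ open U, U x, open W & homeo_between U (W `&` H) f].

Definition surface_with_boundary : Prop :=
  [/\ hausdorff_space T, @second_countable T &
      forall x : T, has_chart_in half_plane x].

Definition surface_boundary : set T := [set x | ~ has_chart_in setT x].

End Surfaces.
Arguments half_plane R : clear implicits.
Arguments has_chart_in {R T} H x.
Arguments surface_with_boundary R T : clear implicits.
Arguments surface_boundary R T : clear implicits.

Definition closed_disc (R : realType) : set (R * R) :=
  [set p | p.1 ^+ 2 + p.2 ^+ 2 <= 1].

Definition circle_point (R : realType) (t : R) : R * R := (cos t, sin t).

Definition circle_arc (R : realType) (l r : R) : set (R * R) :=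
  @circle_point R @` [set t | l <= t <= r].

(* A nondegenerate line segment lying on the boundary of the disc that is
   parametrized by [phi]. *)
Definition boundary_segment (R : realType) (T : Type) (phi : R * R -> T)
    (A : set T) : Prop :=
  exists l r : R, [/\ l < r, r < l + 2 * pi & A = phi @` circle_arc l r].

(* The vertices and the edges are closed discs in the surface, each given with
   a parametrization by the unit disc.  [segs] indexes the line segments in
   which vertices and edges meet, that is, the ends of the edges. *)
Record ribbon_graph (R : realType) := RibbonGraph {
  surf : topologicalType;
  verts : finType;
  edges : finType;
  segs : finType;
  vmap : verts -> R * R -> surf;
  emap : edges -> R * R -> surf;
  seg : segs -> set surf;
  svert : segs -> verts;
  sedge : segs -> edges;
  vdisc := fun v : verts => vmap v @` @closed_disc R;
  edisc := fun e : edges => emap e @` @closed_disc R;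
  surfP : surface_with_boundary R surf;
  vmapP : forall v, homeo_between (@closed_disc R) (vdisc v) (vmap v);
  emapP : forall e, homeo_between (@closed_disc R) (edisc e) (emap e);
  discs_cover : (\bigcup_v vdisc v) `|` (\bigcup_e edisc e) = [set: surf];
  vdisc_disjoint : trivIset [set: verts] vdisc;
  edisc_disjoint : trivIset [set: edges] edisc;
  vdiscI_edisc : forall v e,
    vdisc v `&` edisc e =
      \bigcup_(s in [set s | svert s = v /\ sedge s = e]) seg s;
  seg_disjoint : trivIset [set: segs] seg;
  seg_on_vert : forall s, boundary_segment (vmap (svert s)) (seg s);
  seg_on_edge : forall s, boundary_segment (emap (sedge s)) (seg s);
  two_segs : forall e, #|[set s | sedge s == e]%SET| = 2%N
}.

(* Going once around the boundary circle of the vertex [v], one meets exactly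
   the segments listed in [w], in that order. *)
Definition cyclic_order_at (R : realType) (G : ribbon_graph R) (v : verts G)
    (w : seq (segs G)) : Prop :=
  [/\ uniq w, (forall s, (s \in w) = (svert s == v)) &
   exists l r : nat -> R,
    [/\ forall (k : nat) (s0 : segs G), (k < size w)%N ->
          l k < r k /\
          seg (nth s0 w k) = vmap v @` circle_arc (l k) (r k),
        forall k : nat, (k.+1 < size w)%N -> r k < l k.+1 &
        r (size w).-1 < l 0%N + 2 * pi]].

(* a_1, a_2, b_1, a_3, b_2, a_4, b_3, ..., a_N, b_{N-1}, b_N; this is just
   a_1, b_1 when N = 1. *)
Definition petal_word (S : Type) (a b : nat -> S) (N : nat) : seq S :=
  a 1%N :: flatten [seq [:: a i.+1; b i] | i <- iota 1 N.-1] ++ [:: b N].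

(* The petals are the e_i, 1 <= i <= N, with ends a_i and b_i; values at other
   indices are irrelevant.  Every edge is a self-loop since there is only one
   vertex, and it may be twisted or untwisted, since nothing relates the
   directions in which its two ends are attached.  Reversing the direction of
   travel around the vertex and relabelling e_i as e_{N+1-i} (exchanging a
   and b) preserves the word, so orientation plays no role. *)
Definition petal_flower (R : realType) (N : nat) (G : ribbon_graph R) : Prop :=
  #|verts G| = 1%N /\
  exists (e : nat -> edges G) (a b : nat -> segs G),
    [/\ uniq [seq e i | i <- iota 1 N],
        forall x : edges G, x \in [seq e i | i <- iota 1 N],
        forall i : nat, (1 <= i <= N)%N ->
          [/\ a i != b i, sedge (a i) = e i & sedge (b i) = e i] &
        forall v : verts G, cyclic_order_at v (petal_word a b N)].

Definition faces (R : realType) (G : ribbon_graph R) : set (set (surf G)) :=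
  connected_component (surface_boundary R (surf G)) @`
    surface_boundary R (surf G).
Arguments faces {R} G.

(* Main.v *)
(* Cut the boundary of the surface at the 4N corners, the endpoints of the 2N
   segments.  The vertex contributes 2N free arcs (the gaps between consecutive
   ends) and the petals contribute 2N more (their sides), so every face contains
   a corner.  The side arcs of a petal join each corner at one of its ends to a
   corner at its other end, and the gaps join consecutive ends around the vertex.
   Reading the word a_1, a_2, b_1, a_3, b_2, ... from the left, every new corner is
   therefore joined to an earlier one, and all corners lie on the faces of the two
   corners of a_1.  It is never necessary to know whether a petal is twisted, nor
   to show that two faces are distinct.

   The topological input is that the boundary of the surface is exactly the union
   of the closed free arcs.  A point inside a segment has a planar chart obtained
   by gluing two half-discs.  A point of an open free arc has none: its
   neighbourhoods contain punctured half-discs, which are star-shaped, so a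
   planar chart would make a circle null-homotopic in a punctured plane, and this
   is excluded by lifting angles along the homotopy. *)

Require Import Defs.
From mathcomp Require Import all_boot all_order all_algebra.
From mathcomp Require Import all_classical all_reals all_analysis.
From mathcomp Require Import ring lra zify.

Set Implicit Arguments.
Unset Strict Implicit.
Unset Printing Implicit Defensive.

Import Order.TTheory GRing.Theory Num.Theory.
Import numFieldNormedType.Exports.

Local Open Scope classical_set_scope.
Local Open Scope ring_scope.

(** * The circle and winding numbers *)

Lemma continuous_pair (T U V : topologicalType) (f : T -> U) (g : T -> V) :
  continuous f -> continuous g -> continuous (fun x => (f x, g x)).
Proof.
move=> cf cg x; apply: (@cvg_pair _ _ _ _ (nbhs (f x)) (nbhs (g x))).
  exact: cf.
exact: cg.
Qed.

Section Circle.
Variable R : realType.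
Implicit Types t u l r : R.

(** By the double angle formula [cos t = 1] forces [sin (t / 2) = 0], but [t / 2] lies strictly
    between [0] and [pi] unless [t = 0]. *)
Lemma cos_eq1 t : 0 <= t < 2 * pi -> cos t = 1 -> t = 0.
Proof.
move=> /andP[t0 t2] ct; apply/eqP; rewrite eq_le t0 andbT leNgt; apply/negP => tp.
have s0 : 0 < sin (t / 2) by apply: sin_gt0_pi; apply/andP; split; lra.
have E := cos_mulr2n (t / 2); have P := cos2Dsin2 (t / 2).
have {}E : cos t = cos (t / 2) ^+ 2 *+ 2 - 1.
  by rewrite -E; congr cos; rewrite mulr2n -splitr.
by rewrite ct in E; nra.
Qed.

Lemma circle_point_inj t u : t <= u < t + 2 * pi ->
  circle_point t = circle_point u -> t = u.
Proof.
move=> /andP[tu ut] [ec es]; apply/eqP; rewrite eq_sym -subr_eq0; apply/eqP.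
apply: cos_eq1; first by apply/andP; split; lra.
by rewrite cosB -ec -es -!expr2 cos2Dsin2.
Qed.

Lemma circle_pointDn t n : circle_point (t + (2 * pi) *+ n) = circle_point t.
Proof.
have -> : 2 * pi = pi *+ 2 :> R by rewrite mulr_natl.
by rewrite /circle_point (periodicn (@cosD2pi R)) (periodicn (@sinD2pi R)).
Qed.

(** [acos], up to sign, supplies one angle, which whole turns then bring into the window starting at
    [l]. *)
Lemma circle_point_surj l (p : R * R) : p.1 ^+ 2 + p.2 ^+ 2 = 1 ->
  exists2 t, l <= t < l + 2 * pi & circle_point t = p.
Proof.
case: p => x y /= xy.
have [t0 t0E] : exists t, circle_point t = (x, y).
  have x1 : -1 <= x <= 1 by apply/andP; split; nra.
  have cx : cos (acos x) = x by rewrite acosK// in_itv.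
  have sx : sin (acos x) = `|y|.
    by rewrite sin_acos// -sqrtr_sqr; congr Num.sqrt; lra.
  have [y0|y0] := leP 0 y.
    by exists (acos x); rewrite /circle_point cx sx ger0_norm.
  by exists (- acos x); rewrite /circle_point cosN sinN cx sx ltr0_norm ?opprK.
have pi0 : 0 < 2 * pi :> R by have := @pi_gt0 R; lra.
(* Truncation to [nat] requires a nonnegative argument: the angle is first raised above [l] by [k]
   turns, then lowered by [n] turns. *)
have [k kP] : exists k : nat, t0 + (2 * pi) *+ k >= l.
  exists (Num.truncn (`|l - t0| / (2 * pi))).+1; rewrite -mulr_natr.
  have := truncnS_gt (`|l - t0| / (2 * pi)); rewrite ltr_pdivrMr//.
  by have := ler_norm (l - t0); lra.
pose t1 := t0 + (2 * pi) *+ k.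
pose n := Num.truncn ((t1 - l) / (2 * pi)).
have /andP[n1 n2] : n%:R <= (t1 - l) / (2 * pi) < n.+1%:R.
  by rewrite truncn_le truncnS_gt andbT divr_ge0 ?subr_ge0// ltW.
move: n1 n2; rewrite ler_pdivlMr// ltr_pdivrMr// => n1 n2.
exists (t1 - n%:R * (2 * pi)).
  apply/andP; split; first lra.
  by move: n2; rewrite -natr1; lra.
rewrite -(circle_pointDn _ n) -t0E -(circle_pointDn t0 k) -/t1; congr circle_point.
by rewrite -mulr_natl; lra.
Qed.

Lemma continuous_circle_point : continuous (@circle_point R).
Proof.
by apply: continuous_pair; [exact: continuous_cos|exact: continuous_sin].
Qed.

End Circle.

(** * Plane loops of winding number zero *)

Section Winding.
Variable R : realType.

Definition dotp (p q : R * R) : R := p.1 * q.1 + p.2 * q.2.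

(* The angle along [f] lifts to a function taking the same value at both ends of
   [[0, 2 pi]]; this is the winding number zero condition when [f] is a loop. *)
Definition null_loop (f : R -> R * R) : Prop := exists theta : R -> R,
  [/\ continuous theta, theta 0 = theta (2 * pi) &
      forall s, exists2 k, 0 < k & f s = (k * cos (theta s), k * sin (theta s))].

Lemma continuous_fst (T : topologicalType) (f : T -> R * R) :
  continuous f -> continuous (fun x => (f x).1).
Proof.
by move=> cf x; apply: (@continuous_comp _ _ _ f fst); [exact: cf|exact: cvg_fst].
Qed.

Lemma continuous_snd (T : topologicalType) (f : T -> R * R) :
  continuous f -> continuous (fun x => (f x).2).
Proof.
by move=> cf x; apply: (@continuous_comp _ _ _ f snd); [exact: cf|exact: cvg_snd].
Qed.

Lemma continuous_dotp (T : topologicalType) (f g : T -> R * R) :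
  continuous f -> continuous g -> continuous (fun x => dotp (f x) (g x)).
Proof.
move=> cf cg x; apply: cvgD; apply: cvgM.
- exact: continuous_fst.
- exact: continuous_fst.
- exact: continuous_snd.
- exact: continuous_snd.
Qed.

(** The directions of [f] and [g] differ by less than a right angle. Adding this difference to a
    lift for [f] gives a lift for [g], and the difference agrees at [0] and [2 * pi] because both
    loops close up. *)
Lemma null_loop_dotp (f g : R -> R * R) : continuous f -> continuous g ->
  f 0 = f (2 * pi) -> g 0 = g (2 * pi) ->
  (forall s, 0 < dotp (f s) (g s)) -> null_loop f -> null_loop g.
Proof.
move=> cf cg f02 g02 fg [th [cth th02 thP]].
pose cr s := (f s).1 * (g s).2 - (f s).2 * (g s).1.
pose x s := cr s / dotp (f s) (g s).
(* Since [dotp (f s) (g s) > 0], the angle from [f s] to [g s] is the arctangent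
   of [x s]. *)
exists (fun s => th s + atan (x s)); split.
- move=> s; apply: cvgD; first exact: cth.
  apply: (@continuous_comp _ _ _ x (@atan R)); last exact: continuous_atan.
  apply: cvgM.
    apply: cvgB; apply: cvgM; [exact: continuous_fst|exact: continuous_snd|
      exact: continuous_snd|exact: continuous_fst].
  by apply: cvgV; [exact: lt0r_neq0|exact: continuous_dotp].
- by rewrite th02 /x /cr f02 g02.
- move=> s; have [k k0 fE] := thP s; have := fg s; rewrite /x /cr.
  move: (g s) => [g1 g2]; rewrite fE /dotp /=.
  set C := cos (th s); set S := sin (th s).
  have CS : C ^+ 2 + S ^+ 2 = 1 by exact: cos2Dsin2.
  set c := k * C * g2 - _; set d := k * C * g1 + _ => d0.
  set W := Num.sqrt (1 + (c / d) ^+ 2).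
  have W0 : 0 < W by rewrite sqrtr_gt0 ltr_pwDl// sqr_ge0.
  have ca : cos (atan (c / d)) = W^-1 by exact: cos_atan.
  have sa : sin (atan (c / d)) = c / d / W.
    rewrite -[X in _ = X / _](atanK (c / d)) /tan ca invrK mulfK//.
    exact: lt0r_neq0.
  (* This is the length of [g s]: [c] and [d] are the cross and dot products of [f s] and [g s], and
     [k] is the length of [f s]. *)
  exists (d * W / k); first by rewrite !mulr_gt0 ?invr_gt0.
  rewrite cosD sinD ca sa -/C -/S.
  have [kn dn Wn] : [/\ k != 0, d != 0 & W != 0] by split; exact: lt0r_neq0.
  congr pair.
    transitivity ((d * C - S * c) / k); last by field; rewrite kn dn Wn.
    rewrite /d /c; transitivity ((C ^+ 2 + S ^+ 2) * g1); last by field.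
    by rewrite CS mul1r.
  transitivity ((d * S + C * c) / k); last by field; rewrite kn dn Wn.
  rewrite /d /c; transitivity ((C ^+ 2 + S ^+ 2) * g2); last by field.
  by rewrite CS mul1r.
Qed.

(** A lift [th] would satisfy [cos (s - th s) = 1] for all [s], yet [s - th s] grows by [2 * pi]
    over one turn and so takes the value half a turn past its initial one, where the cosine is
    [-1]. *)
Lemma null_loop_circle e : 0 < e ->
  ~ null_loop (fun s => (e * cos s, e * sin s)).
Proof.
move=> e0 [th [cth th02 thP]].
have p0 := @pi_gt0 R.
have H s : cos (s - th s) = 1.
  have [k k0 [E1 E2]] := thP s.
  have ke : k = e.
    have H1 := cos2Dsin2 s; have H2 := cos2Dsin2 (th s).
    apply/eqP; rewrite -(eqrXn2 (n := 2)) ?ltW//; apply/eqP.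
    rewrite -[LHS]mulr1 -[RHS]mulr1 -{1}H2 -H1 !mulrDr -!exprMn.
    by rewrite E1 E2.
  have [E3 E4] : cos s = cos (th s) /\ sin s = sin (th s).
    by split; apply: (mulfI (lt0r_neq0 e0)); rewrite ?E1 ?E2 ke.
  by rewrite cosB E3 E4 -!expr2 cos2Dsin2.
have cg : continuous (fun s => s - th s) by move=> s; apply: cvgB => //; exact: cth.
have [|||c _ cE] := @IVT R (fun s => s - th s) 0 (2 * pi) (pi - th 0).
- lra.
- exact: continuous_subspaceT.
- by rewrite sub0r -th02 ge_min le_max; apply/andP; split; apply/orP; [left|right]; lra.
- have := H c; rewrite cE addrC cosDpi => H1.
  by have := H 0; rewrite sub0r; lra.
Qed.

(** The times at which the loop is a [null_loop] form a clopen subset of the line. It contains [1],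
    where the loop is constant, hence also [0]. Periodicity is phrased through [circle_point] so
    that every angle can be moved into [[0, 2 pi]]. *)
Lemma circle_not_null_homotopic e (F : R * R -> R * R) : 0 < e ->
  continuous F -> (forall p, F p != 0) ->
  (forall s s' t, circle_point s = circle_point s' -> F (s, t) = F (s', t)) ->
  (forall s, F (s, 0) = (e * cos s, e * sin s)) ->
  (forall s, F (s, 1) = F (0, 1)) -> False.
Proof.
move=> e0 cF F0 Fper F_0 F_1; apply: (null_loop_circle e0).
have cFt t : continuous (fun s => F (s, t)).
  have cp : continuous (fun s : R => (s, t)).
    by apply: continuous_pair => x; [exact: cvg_id|exact: cvg_cst].
  by move=> s; apply: (continuous_comp (cp s)); exact: cF.
have F02 t : F (0, t) = F (2 * pi, t).
  apply: Fper; rewrite -(circle_pointDn 0 1) mulr1n; congr circle_point; lra.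
pose A := [set t | null_loop (fun s => F (s, t))].
(* Compactness of [[0, 2 pi]] makes the neighbourhood of [t0] uniform in [s]; periodicity then
   extends the bound to all [s]. *)
have near_dot t0 : \forall t \near t0, forall s, 0 < dotp (F (s, t)) (F (s, t0)).
  have : \forall t \near t0, `[0, 2 * pi] `<=`
      [set s | 0 < dotp (F (s, t)) (F (s, t0))].
    have /compact_near_coveringP H := @segment_compact R 0 (2 * pi).
    apply: (H _ (nbhs t0) (fun t s => 0 < dotp (F (s, t)) (F (s, t0)))) => s _.
    pose D (p : R * R) := dotp (F p) (F (p.1, t0)).
    have cD : continuous D.
      have cp : continuous (fun p : R * R => (p.1, t0)).
        by apply: continuous_pair => x; [exact: cvg_fst|exact: cvg_cst].
      by apply: continuous_dotp => // p; apply: (continuous_comp (cp p)); exact: cF.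
    have D0 : 0 < D (s, t0).
      rewrite /D /dotp /= -!expr2; have := F0 (s, t0).
      case: (F (s, t0)) => a b /=; apply: contraNT => ab.
      have [a0 b0] : a = 0 /\ b = 0 by split; nra.
      by rewrite a0 b0.
    have [[X Y] /= XY sub] := cvgr_gt (D (s, t0)) (cD (s, t0)) 0 D0.
    by exists (X, Y) => // -[u v] /sub.
  apply: filterS => t H s.
  have /(circle_point_surj 0)[s' /andP[s0 s2] E] :
    (circle_point s).1 ^+ 2 + (circle_point s).2 ^+ 2 = 1 by exact: cos2Dsin2.
  rewrite -!(Fper _ _ _ E); apply: H; rewrite /= in_itv /= s0; lra.
have AP t0 : \forall t \near t0, A t <-> A t0.
  apply: filterS (near_dot t0) => t H; split; apply: null_loop_dotp => // s.
  by rewrite /dotp mulrC [X in _ + X]mulrC; exact: H.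
have AT : A = setT.
  have : connected [set: R] by exact/connected_intervalP.
  apply.
  - exists 1; have := F0 (0, 1); case F1 : (F (0, 1)) => [a b] ab0.
    have ab : 0 < a ^+ 2 + b ^+ 2.
      rewrite lt_def addr_ge0 ?sqr_ge0// andbT; apply: contra ab0 => /eqP ab.
      by apply/eqP; congr pair; nra.
    pose k := Num.sqrt (a ^+ 2 + b ^+ 2).
    have k0 : 0 < k by rewrite sqrtr_gt0.
    have [t _ [ta tb]] : exists2 t, 0 <= t < 0 + 2 * pi &
        circle_point t = (a / k, b / k).
      apply: circle_point_surj; rewrite /= !exprMn -mulrDl exprVn sqr_sqrtr ?ltW//.
      by rewrite mulfV// gt_eqF.
    exists (fun=> t); split=> // [x|s]; first exact: cvg_cst.
    exists k => //; rewrite F_1 F1 ta tb.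
    by congr pair; rewrite mulrC divfK// gt_eqF.
  - exists A; last by rewrite setTI.
    rewrite openE => t At; rewrite /interior.
    by apply: filterS (AP t) => u [_]; apply.
  - exists A; last by rewrite setTI.
    rewrite -openC openE => t At; rewrite /interior.
    by apply: filterS (AP t) => u [H _] /H.
have : A 0 by rewrite AT.
by rewrite /A /=; under eq_fun do rewrite F_0.
Qed.

End Winding.

(** * Discs in a surface *)

Section Topology.
Implicit Types X Y Z S T : topologicalType.

Lemma within_comp X Y Z (A : set X) (B : set Y) (u : X -> Y) (k : Y -> Z) :
  {within A, continuous u} -> {within B, continuous k} ->
  (forall x, A x -> B (u x)) -> {within A, continuous (k \o u)}.
Proof.
move=> /subspace_continuousP cu /subspace_continuousP ck AB.
apply/subspace_continuousP => x Ax P Pk.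
have H := cu x Ax _ (ck (u x) (AB x Ax) P Pk).
apply: (@filterS _ (nbhs x) _ _ _ _ H) => y Hy Ay; exact: Hy Ay (AB _ Ay).
Qed.

(** A closed part of [K] is compact, so its image is closed; hence preimages of closed sets under
    [gi] are closed. *)
Lemma compact_inj_inverse S T (K : set S) (g : S -> T) (gi : T -> S) :
  hausdorff_space T -> compact K -> {within K, continuous g} ->
  (forall p, K p -> gi (g p) = p) -> {within g @` K, continuous gi}.
Proof.
move=> hT cK cg giK; apply/continuous_closedP => C clC.
apply/closed_subspaceP; exists (g @` (K `&` C)).
  apply: compact_closed => //; apply: continuous_compact.
    by apply: continuous_subspaceW cg => p [].
  exact: compact_closedI.
apply/seteqP; split=> [_ [[p [Kp Cp] <-] gK]|y [Cy [p Kp pE]]].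
  by split=> //; rewrite /from_subspace /preimage /= giK.
move: Cy; rewrite -pE /from_subspace /preimage /= giK// => Cp.
by split; exists p.
Qed.

End Topology.

(** * Strict convexity of the disc *)

Section PlaneGeometry.
Variable R : realType.

Lemma unit_coord_le1 (x y : R) : x ^+ 2 + y ^+ 2 = 1 -> `|x| <= 1.
Proof.
move=> xy; have : `|x| ^+ 2 <= 1 ^+ 2.
  by rewrite real_normK ?num_real// expr1n -xy lerDl sqr_ge0.
by rewrite ler_sqr ?nnegrE.
Qed.

(** The squared distance from [p] to [c] is nonnegative; in the case of equality it vanishes. Thus
    the tangent at [c] meets the disc in [c] alone. *)
Lemma disc_dotp_le1 (p c : R * R) : closed_disc p -> c.1 ^+ 2 + c.2 ^+ 2 = 1 ->
  dotp p c <= 1 ?= iff (p == c).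
Proof.
rewrite /closed_disc /dotp; case: p c => p1 p2 [c1 c2] /= pD cC.
have s1 := sqr_ge0 (p1 - c1); have s2 := sqr_ge0 (p2 - c2).
split; first nra.
apply/eqP/eqP => [E|[-> ->]]; last by rewrite -!expr2.
have [z1 z2] : (p1 - c1) ^+ 2 = 0 /\ (p2 - c2) ^+ 2 = 0 by split; nra.
by congr pair; apply/eqP; rewrite -subr_eq0 -sqrf_eq0 ?z1 ?z2.
Qed.

(** One coordinate of the contraction used in [disc_circle_boundary]: [y] moves linearly to
    [(1 - e') * z], and both ends of this path are within [e] of [z]. *)
Lemma near_convex (t y z e e' : R) : 0 <= t <= 1 -> 0 < e' < e -> `|z| <= 1 ->
  `|z - y| < e -> `|z - ((1 - t) * y + t * ((1 - e') * z))| < e.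
Proof.
move=> /andP[t0 t1] /andP[e'0 e'e] z1 zy.
have -> : z - ((1 - t) * y + t * ((1 - e') * z)) =
          (1 - t) * (z - y) + t * (e' * z) by ring.
apply: le_lt_trans (ler_normD _ _) _; rewrite !normrM.
rewrite (ger0_norm t0) (gtr0_norm e'0) ger0_norm ?subr_ge0//.
have ez : e' * `|z| < e by apply: le_lt_trans e'e; rewrite ler_piMr// ltW.
have [->|tn] := eqVneq t 0; first by rewrite subr0 mul0r addr0 mul1r.
have tp : 0 < t by rewrite lt_def tn.
have H1 : (1 - t) * `|z - y| <= (1 - t) * e by rewrite ler_wpM2l ?subr_ge0// ltW.
have H2 : t * (e' * `|z|) < t * e by rewrite ltr_pM2l.
lra.
Qed.

Lemma disc_convex (p c : R * R) t e' : closed_disc p ->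
  c.1 ^+ 2 + c.2 ^+ 2 = 1 -> 0 <= t <= 1 -> 0 < e' < 1 ->
  closed_disc ((1 - t) * p.1 + t * ((1 - e') * c.1),
               (1 - t) * p.2 + t * ((1 - e') * c.2)).
Proof.
move=> pD cC /andP[t0 t1] /andP[e0 e1]; have [+ _] := disc_dotp_le1 pD cC.
move: pD cC; rewrite /closed_disc /dotp; case: p c => a b [c1 c2] /= ab c12 abc.
set u := 1 - t; set v := t * (1 - e').
have u0 : 0 <= u by rewrite subr_ge0.
have v0 : 0 <= v by rewrite mulr_ge0// subr_ge0 ltW.
have uv : u + v <= 1.
  by rewrite /u /v mulrBr mulr1 addrA subrK gerBl mulr_ge0// ltW.
have H1 : u ^+ 2 * (a ^+ 2 + b ^+ 2) <= u ^+ 2 by rewrite ler_piMr// sqr_ge0.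
have H2 : 2 * (u * v) * (a * c1 + b * c2) <= 2 * (u * v).
  by rewrite ler_piMr// mulr_ge0// mulr_ge0.
have H3 : v ^+ 2 * (c1 ^+ 2 + c2 ^+ 2) = v ^+ 2 by rewrite c12 mulr1.
have H4 : (u + v) ^+ 2 <= 1 by rewrite expr_le1// addr_ge0.
rewrite !(mulrA t) -/v; lra.
Qed.

(** The product with [c] is below [1] at [p] and equals [1 - e'] at the other end, so it stays below
    [1] on the segment, while it is [1] at [c]. *)
Lemma disc_convex_neq (p c : R * R) t e' : closed_disc p -> p <> c ->
  c.1 ^+ 2 + c.2 ^+ 2 = 1 -> 0 <= t <= 1 -> 0 < e' < 1 ->
  ((1 - t) * p.1 + t * ((1 - e') * c.1),
   (1 - t) * p.2 + t * ((1 - e') * c.2)) <> c.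
Proof.
move=> pD pc cC /andP[t0 t1] /andP[e0 e1]; have [pc1 pc2] := disc_dotp_le1 pD cC.
have {}pc1 : dotp p c < 1.
  by rewrite lt_neqAle pc2 pc1 andbT; exact/eqP.
move: cC pc1; rewrite /dotp; case: p c {pD pc pc2} => a b [x1 x2] /= c1 ab [E1 E2].
have : (1 - t) * (a * x1 + b * x2) + t * ((1 - e') * (x1 ^+ 2 + x2 ^+ 2)) =
    ((1 - t) * a + t * ((1 - e') * x1)) * x1 +
    ((1 - t) * b + t * ((1 - e') * x2)) * x2 by ring.
rewrite E1 E2 -!expr2 c1 mulr1 => E.
have [t_0|tn] := eqVneq t 0; first by move: E; rewrite t_0; lra.
have tp : 0 < t by rewrite lt_def tn.
have H1 : (1 - t) * (a * x1 + b * x2) <= (1 - t).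
  by rewrite ler_piMr ?subr_ge0// ltW.
have H2 : t * (1 - e') < t by rewrite gtr_pMr// gtrBl.
lra.
Qed.

End PlaneGeometry.

(** * Planar charts and boundary points of an embedded disc *)

Section Charts.
Variables (R : realType) (T : topologicalType).
Hypothesis hT : hausdorff_space T.

Lemma ex_inverse (K : set (R * R)) (g : R * R -> T) :
  (forall p q, K p -> K q -> g p = g q -> p = q) ->
  exists gi : T -> R * R, forall p, K p -> gi (g p) = p.
Proof.
move=> gI; exists (fun y => xget 0 [set p | K p /\ g p = y]) => p Kp.
have [] : [set q | K q /\ g q = g p] (xget 0 [set q | K q /\ g q = g p]).
  by apply: xgetPex; exists p.
by move=> Kq /gI; apply.
Qed.

(** The chart is the inverse of [g] over [W]; compactness of [K] makes it continuous. *)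
Lemma chart_of_embedding (K W : set (R * R)) (g : R * R -> T) (x : T) :
  compact K -> open W -> W `<=` K -> {within K, continuous g} ->
  (forall p q, K p -> K q -> g p = g q -> p = q) ->
  open (g @` W) -> (g @` W) x -> has_chart_in (@setT (R * R)) x.
Proof.
move=> cK oW WK cg gI ogW gWx; have [gi giK] := ex_inverse gI.
exists (g @` W), W, gi; split=> //; rewrite setIT; split.
- split.
  + by move=> _ [p Wp <-]; rewrite giK//; exact: WK.
  + move=> y z; rewrite !inE => -[p Wp <-] [q Wq <-].
    by rewrite !giK; try exact: WK; move=> ->.
  + by move=> p Wp; exists (g p); [exists p|rewrite giK//; exact: WK].
- apply: continuous_subspaceW (compact_inj_inverse hT cK cg giK).
  exact: image_subset.
- exists g; split; last exact: continuous_subspaceW cg.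
  by move=> y; rewrite inE => -[p Wp <-]; rewrite giK//; exact: WK.
Qed.

(** A planar chart at one point serves every point of its domain. *)
Lemma closed_surface_boundary : closed (surface_boundary R T).
Proof.
rewrite -openC openE => x /contrapT [U [W [f [oU Ux oW h]]]].
rewrite /interior; apply: filterS (open_nbhs_nbhs (conj oU Ux)) => y Uy.
by apply; exists U, W, f.
Qed.

Lemma continuous_sqnorm : continuous (fun p : R * R => p.1 ^+ 2 + p.2 ^+ 2).
Proof.
move=> p; apply: cvgD; apply: (@continuous_comp _ _ _ _ (fun x : R => x ^+ 2)).
- exact: cvg_fst.
- exact: exprn_continuous.
- exact: cvg_snd.
- exact: exprn_continuous.
Qed.

Lemma compact_closed_disc : compact (@closed_disc R).
Proof.
have cf := continuous_sqnorm.
have clD : closed (@closed_disc R).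
  have -> : @closed_disc R =
    (fun p : R * R => p.1 ^+ 2 + p.2 ^+ 2) @^-1` [set x | x <= 1] by [].
  by apply: closed_comp => //; exact: closed_le.
apply: (subclosed_compact clD (compact_setX (@segment_compact R (-1) 1)
  (@segment_compact R (-1) 1))).
move=> -[x y]; rewrite /closed_disc /= => xy; rewrite !in_itv /=.
by split; apply/andP; split; nra.
Qed.

Lemma open_open_disc : open [set p : R * R | p.1 ^+ 2 + p.2 ^+ 2 < 1].
Proof.
have cf := continuous_sqnorm.
have -> : [set p : R * R | p.1 ^+ 2 + p.2 ^+ 2 < 1] =
    (fun p : R * R => p.1 ^+ 2 + p.2 ^+ 2) @^-1` [set x | x < 1] by [].
by apply: open_comp => //; exact: open_lt.
Qed.

Variables (phi : R * R -> T) (Z : set T).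
Hypothesis cphi : {within @closed_disc R, continuous phi}.
Hypothesis phiI : forall p q, @closed_disc R p -> @closed_disc R q ->
  phi p = phi q -> p = q.
Hypothesis clZ : closed Z.
Hypothesis cover : forall x, (phi @` @closed_disc R) x \/ Z x.

(** The complement is the union of [Z] and the image of the compact rest of the disc. *)
Lemma open_disc_image (O : set (R * R)) : open O ->
  (forall p, @closed_disc R p -> O p -> ~ Z (phi p)) ->
  open (phi @` (@closed_disc R `&` O)).
Proof.
move=> oO OZ; rewrite -closedC.
have -> : ~` (phi @` (@closed_disc R `&` O)) =
    phi @` (@closed_disc R `&` ~` O) `|` Z.
  apply/seteqP; split=> [x nx|x []].
  - have [[p Dp pE]|] := cover x; last by right.
    by left; exists p => //; split=> // Op; apply: nx; exists p.
  - by move=> [p [Dp nOp] <-] [q [Dq Oq] /phiI qp]; apply: nOp; rewrite -qp.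
  - by move=> Zx [p [Dp Op] pE]; apply: (OZ p) => //; rewrite pE.
apply: closedU => //; apply: compact_closed => //.
apply: continuous_compact; first by apply: continuous_subspaceW cphi => p [].
by apply: compact_closedI; [exact: compact_closed_disc|exact: open_closedC].
Qed.

Lemma open_disc_interior p : p.1 ^+ 2 + p.2 ^+ 2 < 1 ->
  (forall q, q.1 ^+ 2 + q.2 ^+ 2 < 1 -> ~ Z (phi q)) ->
  has_chart_in (@setT (R * R)) (phi p).
Proof.
move=> p1 nZ; pose W := [set p : R * R | p.1 ^+ 2 + p.2 ^+ 2 < 1].
have WD : W `<=` @closed_disc R by move=> q /ltW.
apply: (chart_of_embedding compact_closed_disc open_open_disc WD) => //.
  rewrite -[X in phi @` X](setIidr WD); apply: open_disc_image; first exact: open_open_disc.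
  by move=> q _; exact: nZ.
Qed.

(* [Z] is the rest of the surface.  A planar chart at [phi c] would let us pull a
   small circle around the image of [c] back to [closed_disc `&` O] minus [c],
   where it contracts linearly to the point [(1 - e') c], as [c] is an extreme
   point of the disc. *)
Lemma disc_circle_boundary c : c.1 ^+ 2 + c.2 ^+ 2 = 1 -> ~ Z (phi c) ->
  surface_boundary R T (phi c).
Proof.
move=> c1 nZc [U [W [f [oU Uc oW]]]]; rewrite setIT => -[fUW cf [g [gf cg]]].
have Dc : closed_disc c by rewrite /closed_disc /= c1.
have [psi psiK] := ex_inverse phiI.
have cpsi := compact_inj_inverse hT compact_closed_disc cphi psiK.
have [e e0 He] : exists2 e, 0 < e & forall p, closed_disc p -> ball c e p ->
    U (phi p) /\ ~ Z (phi p).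
  have oUZ : open (U `&` ~` Z) by apply: openI => //; exact: closed_openC.
  have nUZ : nbhs (phi c) (U `&` ~` Z) by apply: open_nbhs_nbhs.
  move/subspace_continuousP : cphi => /(_ c Dc _ nUZ).
  by move=> /nbhs_ballP[e e0 He]; exists e => // p Dp /He; apply.
pose O : set (R * R) := ball c e.
have oO : open O by exact: ball_open.
pose V := phi @` (@closed_disc R `&` O).
have oV : open V by apply: open_disc_image => // p Dp /(He p Dp)[].
have VU : V `<=` U by move=> _ [p [Dp Op] <-]; have [] := He p Dp Op.
(* Writing the image of [V] as a preimage under the inverse [g] carries openness from the surface to
   the plane. *)
have fgV : f @` V = W `&` g @^-1` V.
  apply/seteqP; split=> [_ [v Vv <-]|w [Ww gw]].
    by split; [exact: set_bij_homo fUW _ (VU _ Vv)|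
      rewrite /preimage /= gf ?inE//; exact: VU].
  exists (g w) => //; have [u Uu <-] := set_bij_surj fUW Ww.
  by rewrite gf ?inE.
have ofV : open (f @` V).
  have : {in W, continuous g} by rewrite -continuous_open_subspace.
  by move=> /(continuous_inP _ oW)/(_ _ oV); rewrite -fgV.
have Vc : V (phi c) by exists c => //; split=> //; exact: ballxx.
have [r r0 Hr] : exists2 r, 0 < r & ball (f (phi c)) r `<=` f @` V.
  by apply/nbhs_ballP; apply: open_nbhs_nbhs; split=> //; exists (phi c).
pose q := f (phi c).
pose gam (s : R) := (q.1 + r / 2 * cos s, q.2 + r / 2 * sin s).
have gamV s : (f @` V) (gam s).
  apply: Hr; split; rewrite /ball /= opprD addNKr normrN normrM gtr0_norm ?divr_gt0//.
    by have := cos_max s; have := normr_ge0 (cos s); nra.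
  by have := sin_max s; have := normr_ge0 (sin s); nra.
(* The circle [gam] pulled back to the disc through the chart. *)
pose pb s := psi (g (gam s)).
have pbP s : [/\ closed_disc (pb s), O (pb s) & f (phi (pb s)) = gam s].
  have [v Vv vE] := gamV s; have [p [Dp Op] pE] := Vv.
  rewrite /pb -vE gf; last by rewrite inE; exact: VU.
  by rewrite -pE psiK// pE.
have cpb : continuous pb.
  have cgam : continuous gam.
    apply: continuous_pair => s; apply: cvgD; try exact: cvg_cst;
      apply: cvgM; try exact: cvg_cst; [exact: continuous_cos|exact: continuous_sin].
  have cgV : {within f @` V, continuous g}.
    by apply: continuous_subspaceW cg; rewrite fgV; exact: subIsetl.
  have cpg : {within f @` V, continuous (psi \o g)}.
    apply: (within_comp cgV cpsi) => _ [v Vv <-].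
    by rewrite gf; [case: Vv => p [Dp _] <-; exists p|rewrite inE; exact: VU].
  apply/continuous_subspace_setT.
  apply: (within_comp (u := gam) _ cpg) => // s.
  by move/continuous_subspace_setT: cgam; exact.
have fphiI p p' : closed_disc p -> O p -> closed_disc p' -> O p' ->
    f (phi p) = f (phi p') -> p = p'.
  move=> Dp Op Dp' Op' E; apply: phiI => //.
  by apply: (set_bij_inj fUW) => //; rewrite inE; [case: (He p)|case: (He p')].
(* Below [e], so that the contraction stays in the ball [O]; below [1], so that its target lies in
   the disc. *)
pose e' := Num.min e 1 / 2.
have [e'0 e'e e'1] : [/\ 0 < e', e' < e & e' < 1].
  rewrite /e'; split.
  - by rewrite divr_gt0// lt_min e0 ltr01.
  - have : Num.min e 1 <= e by rewrite ge_min lexx.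
    have : 0 < Num.min e 1 by rewrite lt_min e0 ltr01.
    lra.
  - have : Num.min e 1 <= 1 by rewrite ge_min lexx orbT.
    lra.
(* [clamp] is the retraction of the line onto [[0, 1]]. *)
pose clamp (t : R) := (1 + `|t| - `|t - 1|) / 2.
have clamp01 t : 0 <= clamp t <= 1.
  have := ler_dist_dist t (t - 1).
  have -> : t - (t - 1) = 1 by ring.
  rewrite normr1 ler_norml => /andP[? ?].
  by rewrite /clamp; apply/andP; split; lra.
pose h (x : R * R) : R * R :=
  ((1 - clamp x.2) * (pb x.1).1 + clamp x.2 * ((1 - e') * c.1),
   (1 - clamp x.2) * (pb x.1).2 + clamp x.2 * ((1 - e') * c.2)).
have e'01 : 0 < e' < 1 by rewrite e'0.
have hD x : closed_disc (h x).
  by apply: disc_convex => //; have [] := pbP x.1.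
have hO x : O (h x).
  have [_ [/= O1 O2] _] := pbP x.1.
  have e'0e : 0 < e' < e by rewrite e'0.
  split; apply: near_convex => //; first exact: unit_coord_le1 c1.
  by apply: (@unit_coord_le1 _ _ c.1); rewrite addrC.
(* The pulled-back loop misses [c], whose image [q] is the centre of [gam]; [disc_convex_neq]
   extends this to the whole contraction. *)
have hc x : h x <> c.
  have [Dp _ pE] := pbP x.1; apply: disc_convex_neq => // E.
  rewrite E -/q in pE; have r2 : r / 2 != 0 by rewrite gt_eqF// divr_gt0.
  have C0 : cos x.1 = 0.
    apply: (mulfI r2); apply: (addrI q.1); rewrite mulr0 addr0.
    exact/esym/(congr1 fst pE).
  have S0 : sin x.1 = 0.
    apply: (mulfI r2); apply: (addrI q.2); rewrite mulr0 addr0.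
    exact/esym/(congr1 snd pE).
  have := cos2Dsin2 x.1; rewrite C0 S0 expr0n addr0 => /esym/eqP.
  by rewrite oner_eq0.
have cpb1 : continuous (fun x : R * R => pb x.1).
  by move=> x; apply: (@continuous_comp _ _ _ _ pb); [exact: cvg_fst|exact: cpb].
have ccl : continuous (fun x : R * R => clamp x.2).
  move=> x; apply: (@continuous_comp _ _ _ _ clamp); first exact: cvg_snd.
  apply: cvgM; last exact: cvg_cst.
  apply: cvgB.
    by apply: cvgD; [exact: cvg_cst|exact: norm_continuous].
  by apply: cvg_norm; apply: cvgB; [exact: cvg_id|exact: cvg_cst].
have ch : continuous h.
  apply: continuous_pair => x; apply: cvgD; apply: cvgM.
  - by apply: cvgB; [exact: cvg_cst|exact: ccl].
  - exact: (continuous_fst cpb1).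
  - exact: ccl.
  - exact: cvg_cst.
  - by apply: cvgB; [exact: cvg_cst|exact: ccl].
  - exact: (continuous_snd cpb1).
  - exact: ccl.
  - exact: cvg_cst.
have cfh : continuous (fun x => f (phi (h x))).
  have cphiO : {within @closed_disc R `&` O, continuous phi}.
    by apply: continuous_subspaceW cphi => p [].
  have cfphi : {within @closed_disc R `&` O, continuous (f \o phi)}.
    by apply: (within_comp cphiO cf) => p [Dp Op]; case: (He p Dp Op).
  apply/continuous_subspace_setT; apply: (within_comp (u := h) _ cfphi) => // x.
  by move/continuous_subspace_setT: ch; exact.
(* The contraction seen in the chart, with [q] moved to the origin. *)
pose F x : R * R := ((f (phi (h x))).1 - q.1, (f (phi (h x))).2 - q.2).
have cF : continuous F.
  apply: continuous_pair => x; apply: cvgB; try exact: cvg_cst.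
    exact: (continuous_fst cfh).
  exact: (continuous_snd cfh).
have clamp0 : clamp 0 = 0 by rewrite /clamp normr0 sub0r normrN1; lra.
have clamp1 : clamp 1 = 1 by rewrite /clamp subrr normr0 normr1; lra.
apply: (@circle_not_null_homotopic R (r / 2) F) => //.
- by rewrite divr_gt0.
- move=> x; apply/eqP => Fx0.
  have E1 : (f (phi (h x))).1 = q.1 by apply: subr0_eq; exact: (congr1 fst Fx0).
  have E2 : (f (phi (h x))).2 = q.2 by apply: subr0_eq; exact: (congr1 snd Fx0).
  apply: (hc x); apply: fphiI => //.
    exact: ballxx.
  by rewrite [LHS]surjective_pairing E1 E2 -surjective_pairing.
- by move=> s s' t [E1 E2]; rewrite /F /h /pb /gam /= E1 E2.
- move=> s; rewrite /F /h /= clamp0 subr0 !mul1r !mul0r !addr0.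
  rewrite -surjective_pairing; have [_ _ ->] := pbP s.
  by rewrite /gam /=; congr pair; ring.
- by move=> s; rewrite /F /h /= clamp1 subrr !mul0r.
Qed.

End Charts.

(** * Gluing two discs along an arc *)

Section ArcMatching.
Variables (R : realType) (T : topologicalType).
Hypothesis hT : hausdorff_space T.
Variables (a a' : R -> T) (l r l' r' : R).
Hypotheses (lr : l < r) (lr' : l' < r').
Hypothesis ca : {within `[l, r], continuous a}.
Hypothesis ca' : {within `[l', r'], continuous a'}.
Hypothesis aI : {in `[l, r] &, injective a}.
Hypothesis aI' : {in `[l', r'] &, injective a'}.
Hypothesis aE : a @` `[l, r] = a' @` `[l', r'].

(** Two parametrizations of one arc differ by a homeomorphism [tau] of the parameter segments. It
    maps endpoints to endpoints, in an order left open: this alternative is what makes twists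
    harmless later. *)
Lemma arc_transition : exists tau : R -> R,
  [/\ {within `[l, r], continuous tau},
      forall t, l <= t <= r -> l' <= tau t <= r' /\ a' (tau t) = a t,
      forall t', l' <= t' <= r' -> exists2 t, l <= t <= r & tau t = t',
      forall t, l < t < r -> l' < tau t < r' &
      tau l = l' /\ tau r = r' \/ tau l = r' /\ tau r = l'].
Proof.
pose ai y := xget 0 [set t | t \in `[l', r'] /\ a' t = y].
have aiK t : `[l', r']%classic t -> ai (a' t) = t.
  move=> tlr; have [] : [set u | u \in `[l', r'] /\ a' u = a' t] (ai (a' t)).
    by apply: xgetPex; exists t.
  by move=> u1 /aI'; apply.
have cai := compact_inj_inverse hT (@segment_compact R l' r') ca' aiK.
pose tau t := ai (a t).
have tauP t : l <= t <= r -> l' <= tau t <= r' /\ a' (tau t) = a t.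
  move=> tlr; have : (a @` `[l, r]) (a t) by exists t => //=; rewrite in_itv.
  rewrite aE => -[u ulr uE].
  by rewrite /tau -uE aiK//; split=> //; move: ulr; rewrite /= in_itv.
have ctau : {within `[l, r], continuous tau}.
  apply: (within_comp ca cai) => t tlr.
  by rewrite -aE; exists t.
have tauI t u : l <= t <= r -> l <= u <= r -> tau t = tau u -> t = u.
  move=> tlr ulr E; apply: aI; rewrite ?in_itv//.
  by have [_ <-] := tauP t tlr; have [_ <-] := tauP u ulr; rewrite E.
(* Removing an endpoint from a segment leaves a connected set; removing an
   interior point does not. *)
have endpoint s (J : set R) : l <= s <= r -> connected J ->
    (forall t, J t <-> l <= t <= r /\ t != s) -> tau s = l' \/ tau s = r'.
  move=> slr cJ JE.
  have /connected_intervalP tauJ : connected (tau @` J).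
    apply: connected_continuous_connected => //.
    by apply: continuous_subspaceW ctau => t /JE[] /=; rewrite in_itv.
  have tJ u : l' <= u <= r' -> u != tau s -> (tau @` J) u.
    move=> ulr us; have : (a' @` `[l', r']) (a' u) by exists u => //=; rewrite in_itv.
    rewrite -aE => -[t]; rewrite /= in_itv/= => tlr tE.
    have [t1 t2] := tauP t tlr.
    have E : tau t = u by apply: aI'; rewrite ?in_itv// t2.
    by exists t => //; apply/JE; split=> //; apply: contraNneq us => <-; rewrite E.
  have [/andP[s1 s2] _] := tauP s slr.
  have [->|n1] := eqVneq (tau s) l'; first by left.
  have [->|n2] := eqVneq (tau s) r'; first by right.
  have : (tau @` J) (tau s).
    apply: (tauJ l' r').
    - by apply: tJ; rewrite ?lexx ?ltW// eq_sym.
    - by apply: tJ; rewrite ?lexx ?ltW// eq_sym.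
    - by rewrite s1 s2.
  by move=> [t /JE[tlr ts] /tauI tE]; rewrite tE ?eqxx in ts.
have El : tau l = l' \/ tau l = r'.
  apply: (endpoint l `]l, r]%classic).
  - by rewrite lexx ltW.
  - exact/connected_intervalP/interval_is_interval.
  - move=> t; rewrite /= in_itv/= lt_neqAle eq_sym.
    by split=> [/andP[/andP[-> ->] ->]|[/andP[-> ->] ->]].
have Er : tau r = l' \/ tau r = r'.
  apply: (endpoint r `[l, r[%classic).
  - by rewrite lexx ltW.
  - exact/connected_intervalP/interval_is_interval.
  - move=> t; rewrite /= in_itv/= lt_neqAle.
    by split=> [/andP[-> /andP[-> ->]]|[/andP[-> ->] ->]].
have nlr : tau l != tau r.
  by apply/eqP => /tauI E; move: lr; rewrite E ?ltxx ?lexx ?ltW.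
exists tau; split=> //.
- move=> t' t'lr.
  have : (a' @` `[l', r']) (a' t') by exists t' => //=; rewrite in_itv.
  rewrite -aE => -[t]; rewrite /= in_itv/= => tlr tE; exists t => //.
  by have [t1 t2] := tauP t tlr; apply: aI'; rewrite ?in_itv// t2.
- move=> t /andP[lt tr].
  have tlr : l <= t <= r by rewrite !ltW.
  have [/andP[t1 t2] _] := tauP t tlr.
  have nl : tau t != tau l.
    by apply/eqP => /tauI E; move: lt; rewrite E ?ltxx// lexx ltW.
  have nr : tau t != tau r.
    by apply/eqP => /tauI E; move: tr; rewrite E ?ltxx// lexx ltW.
  rewrite !lt_neqAle t1 t2 !andbT [l' == _]eq_sym.
  by case: El Er nl nr nlr => -> [] ->; rewrite ?eqxx// => -> ->.
- by case: El Er nlr => -> [] ->; rewrite ?eqxx// => _; [left|right].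
Qed.

Lemma arc_endpoints :
  (a l = a' l' /\ a r = a' r') \/ (a l = a' r' /\ a r = a' l').
Proof.
have [tau [_ tauP _ _ tau_lr]] := arc_transition.
have [_ <-] : l' <= tau l <= r' /\ a' (tau l) = a l by apply: tauP; rewrite lexx ltW.
have [_ <-] : l' <= tau r <= r' /\ a' (tau r) = a r by apply: tauP; rewrite lexx ltW.
by case: tau_lr => -[-> ->]; [left|right].
Qed.

End ArcMatching.

(** * Polar coordinates and sectors of the disc *)

Section Sectors.
Variable R : realType.
Implicit Types (p x : R * R) (l r t u : R).

Definition polar x : R * R := (x.1 * cos x.2, x.1 * sin x.2).

Lemma continuous_polar : continuous polar.
Proof.
apply: continuous_pair => x; apply: cvgM.
- exact: cvg_fst.
- by apply: (@continuous_comp _ _ _ _ (@cos R));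
    [exact: cvg_snd|exact: continuous_cos].
- exact: cvg_fst.
- by apply: (@continuous_comp _ _ _ _ (@sin R));
    [exact: cvg_snd|exact: continuous_sin].
Qed.

Lemma polar_norm x : (polar x).1 ^+ 2 + (polar x).2 ^+ 2 = x.1 ^+ 2.
Proof. by rewrite !exprMn -mulrDr cos2Dsin2 mulr1. Qed.

Lemma polar1 t : polar (1, t) = circle_point t.
Proof. by rewrite /polar /= !mul1r. Qed.

Lemma closed_disc_polar u t : 0 <= u <= 1 -> closed_disc (polar (u, t)).
Proof. by move=> /andP[u0 u1]; rewrite /closed_disc /mkset polar_norm expr_le1. Qed.

Lemma closed_disc_circle t : closed_disc (circle_point t).
Proof. by rewrite -polar1; apply: closed_disc_polar; rewrite ler01 lexx. Qed.

Lemma polar_surj l p : closed_disc p ->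
  exists u t, [/\ 0 <= u <= 1, l <= t < l + 2 * pi & p = polar (u, t)].
Proof.
rewrite /closed_disc /=; case: p => a b /= ab1.
have pi0 := @pi_gt0 R.
have ab0 : 0 <= a ^+ 2 + b ^+ 2 by rewrite addr_ge0 ?sqr_ge0.
pose u := Num.sqrt (a ^+ 2 + b ^+ 2).
have u2 : u ^+ 2 = a ^+ 2 + b ^+ 2 by rewrite sqr_sqrtr.
have u01 : 0 <= u <= 1 by rewrite sqrtr_ge0/= -(@expr_le1 _ 2) ?sqrtr_ge0// u2.
(* At the centre any angle in the window will do; [l] is chosen. *)
have [u0|un] := eqVneq u 0.
  exists 0, l; rewrite !lexx ler01; split=> //=; first lra.
  rewrite u0 expr0n /= in u2.
  by rewrite /polar /= !mul0r; congr pair; nra.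
have up : 0 < u by rewrite lt_def un; case/andP: u01.
have [t tl tE] : exists2 t, l <= t < l + 2 * pi & circle_point t = (a / u, b / u).
  by apply: circle_point_surj; rewrite /= !exprMn -mulrDl exprVn u2 mulfV// -u2 sqrf_eq0.
case: tE => ta tb; exists u, t; split=> //.
by rewrite /polar /= ta tb; congr pair; rewrite mulrC divfK.
Qed.

Lemma polar_inj u t u' t' : 0 < u -> 0 <= u' -> polar (u, t) = polar (u', t') ->
  u = u' /\ circle_point t = circle_point t'.
Proof.
move=> u0 u'0 E; have uu' : u = u'.
  have := polar_norm (u, t); rewrite E polar_norm /= => /esym/eqP.
  by rewrite (eqrXn2 _ (ltW u0) u'0)// => /eqP.
split=> //; case: E; rewrite -uu' => E1 E2.
by congr pair; apply: (mulfI (lt0r_neq0 u0)).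
Qed.

(** A one-sided neighbourhood of the open arc in the disc, kept away from the centre, where polar
    coordinates degenerate. *)
Definition sector l r : set (R * R) :=
  [set p | exists u t, [/\ 2^-1 < u <= 1, l < t < r & p = polar (u, t)]].

(* The complement of the sector in the closed disc, written as a union of images
   of compact rectangles. *)
Definition cosector l r : set (R * R) :=
  polar @` (`[0, 1] `*` `[r, l + 2 * pi]) `|` polar @` (`[0, 2^-1] `*` `[l, r]).

Lemma compact_cosector l r : compact (cosector l r).
Proof.
by apply: compactU; apply: continuous_compact;
  try (apply: continuous_subspaceT; exact: continuous_polar);
  apply: compact_setX; exact: segment_compact.
Qed.

Lemma cosector_closed_disc l r : cosector l r `<=` @closed_disc R.
Proof.
move=> _ [[[u t] [/= + _] <-]|[[u t] [/= + _] <-]]; rewrite in_itv/=.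
  exact: closed_disc_polar.
by move=> /andP[u0 u1]; apply: closed_disc_polar; rewrite u0/=; lra.
Qed.

Lemma sector_or_cosector l r p : r < l + 2 * pi -> closed_disc p ->
  sector l r p \/ cosector l r p.
Proof.
move=> rl /(polar_surj l)[u [t [/andP[u0 u1] /andP[t0 t1] ->]]].
have [tr|tr] := leP r t.
  by right; left; exists (u, t) => //; split; rewrite /= in_itv/= ?u0 ?tr// ltW.
have [ul|ul] := leP u 2^-1.
  by right; right; exists (u, t) => //; split; rewrite /= in_itv/= ?u0 ?t0// ltW.
(* The ray at angle [l] is covered by the end [l + 2 * pi] of the first rectangle. *)
have [<-|tl] := eqVneq l t.
  right; left; exists (u, l + 2 * pi).
    by split; rewrite /= in_itv/= ?u0// lexx andbT ltW.
  rewrite /polar /=; have := circle_pointDn l 1.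
  by rewrite mulr1n => -[-> ->].
by left; exists u, t; rewrite ul tr lt_neqAle tl t0.
Qed.

Lemma sector_cosector l r p : r < l + 2 * pi -> sector l r p -> ~ cosector l r p.
Proof.
move=> rl [u [t [/andP[u0 u1] /andP[t0 t1] ->]]].
have up : 0 < u by lra.
move=> [[[u' t'] [/= + +] E]|[[u' t'] [/= + +] E]]; rewrite !in_itv/=.
  move=> /andP[u'0 u'1] /andP[t'0 t'1].
  have [_ /circle_point_inj] := polar_inj up u'0 (esym E).
  have tt' : t <= t' < t + 2 * pi by apply/andP; split; lra.
  by move=> /(_ tt') tE; move: t'0; rewrite -tE leNgt t1.
move=> /andP[u'0 u'1] _.
by have [uu' _] := polar_inj up u'0 (esym E); move: u'1; rewrite -uu' leNgt u0.
Qed.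

End Sectors.

Section Gluing.
Variables (R : realType) (T : topologicalType).
Hypothesis hT : hausdorff_space T.
Variables (phi phi' : R * R -> T) (Z : set T).
Hypothesis cphi : {within @closed_disc R, continuous phi}.
Hypothesis cphi' : {within @closed_disc R, continuous phi'}.
Hypothesis phiI : forall p q, @closed_disc R p -> @closed_disc R q ->
  phi p = phi q -> p = q.
Hypothesis phiI' : forall p q, @closed_disc R p -> @closed_disc R q ->
  phi' p = phi' q -> p = q.
Hypothesis clZ : closed Z.
Hypothesis cover : forall x,
  [\/ (phi @` @closed_disc R) x, (phi' @` @closed_disc R) x | Z x].
Variables (l r l' r' : R).
Hypotheses (lr : l < r) (rl : r < l + 2 * pi).
Hypotheses (lr' : l' < r') (rl' : r' < l' + 2 * pi).
Hypothesis arcE : phi @` circle_arc l r = phi' @` circle_arc l' r'.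
Hypothesis meet : forall p q, closed_disc p -> closed_disc q -> phi p = phi' q ->
  p.1 ^+ 2 + p.2 ^+ 2 = 1 /\ q.1 ^+ 2 + q.2 ^+ 2 = 1.
Hypothesis Zphi : forall p, p.1 ^+ 2 + p.2 ^+ 2 < 1 -> ~ Z (phi p).
Hypothesis Zphi' : forall p, closed_disc p -> ~ Z (phi' p).

Lemma arc_image (f : R * R -> T) u v :
  f @` circle_arc u v = (f \o @circle_point R) @` `[u, v].
Proof. by rewrite image_comp /circle_arc set_itvE. Qed.

Lemma arc_continuous (f : R * R -> T) u v : {within @closed_disc R, continuous f} ->
  {within `[u, v], continuous (f \o @circle_point R)}.
Proof.
move=> cf; apply: (within_comp _ cf) => [|t _]; last exact: closed_disc_circle.
exact/continuous_subspaceT/continuous_circle_point.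
Qed.

Lemma arc_inj (f : R * R -> T) u v : v < u + 2 * pi ->
  (forall p q, closed_disc p -> closed_disc q -> f p = f q -> p = q) ->
  {in `[u, v] &, injective (f \o @circle_point R)}.
Proof.
move=> uv fI t s; rewrite !in_itv/= => /andP[ut tv] /andP[us sv].
move=> /(fI _ _ (closed_disc_circle t) (closed_disc_circle s)).
have [ts|st] := leP t s; first by apply: circle_point_inj; rewrite ts; lra.
by move=> /esym E; apply/esym; apply: circle_point_inj => //; rewrite ltW//; lra.
Qed.

(** The image of the open rectangle is open since its complement is the union of [Z] and the images
    of two compact cosectors. In the application [phi] is a vertex, [phi'] an edge and [Z] the union
    of the other edges. These may touch the circle of the vertex, hence the weaker assumption on
    [phi]. *)
Lemma segment_interior_chart t : l < t < r ->
  has_chart_in (@setT (R * R)) (phi (circle_point t)).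
Proof.
move=> t_lr.
have aE : (phi \o @circle_point R) @` `[l, r] = (phi' \o @circle_point R) @` `[l', r'].
  by rewrite -!arc_image.
have [tau [ctau tauP tauS tau_oo tau_lr]] := arc_transition hT lr lr'
  (arc_continuous cphi) (arc_continuous cphi') (arc_inj rl phiI) (arc_inj rl' phiI') aE.
(* The chart is the inverse of [g], which maps the lower half of a rectangle
   into the first disc and the upper half into the second. *)
pose g1 (x : R * R) := phi (polar (1 + x.2, x.1)).
pose g2 (x : R * R) := phi' (polar (1 - x.2, tau x.1)).
pose g (x : R * R) := if x.2 <= 0 then g1 x else g2 x.
pose K1 : set (R * R) := `[l, r] `*` `[- 2^-1, 0].
pose K2 : set (R * R) := `[l, r] `*` `[0, 2^-1].
pose K := K1 `|` K2.
pose W : set (R * R) := `]l, r[ `*` `]- 2^-1, 2^-1[.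
have KP (x : R * R) : K x <-> l <= x.1 <= r /\ - 2^-1 <= x.2 <= 2^-1.
  split=> [[[]|[]]|[]]; rewrite /= ?in_itv/=.
  - by move=> -> /andP[? ?]; split=> //; apply/andP; split; lra.
  - by move=> -> /andP[? ?]; split=> //; apply/andP; split; lra.
  - move=> x1 /andP[? ?]; have [x0|x0] := leP x.2 0; [left|right];
    by split; rewrite /= in_itv//=; apply/andP; split; lra.
have cK1 : compact K1 by apply: compact_setX; exact: segment_compact.
have cK2 : compact K2 by apply: compact_setX; exact: segment_compact.
have cK : compact K by apply: compactU.
have hRR : hausdorff_space (R * R)%type by exact: norm_hausdorff.
have g12 x : x.2 = 0 -> l <= x.1 <= r -> g1 x = g2 x.
  move=> x0 xlr; rewrite /g1 /g2 x0 addr0 subr0 !polar1.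
  by have [_ /= ->] := tauP _ xlr.
have D1 x : K x -> x.2 <= 0 -> closed_disc (polar (1 + x.2, x.1)).
  by move=> /KP[_ /andP[? ?]] x0; apply: closed_disc_polar; apply/andP; split; lra.
have D2 x : K x -> 0 <= x.2 -> closed_disc (polar (1 - x.2, tau x.1)).
  by move=> /KP[_ /andP[? ?]] x0; apply: closed_disc_polar; apply/andP; split; lra.
have cg : {within K, continuous g}.
  apply: withinU_continuous; [exact: compact_closed|exact: compact_closed| |].
    have cg1 : {within K1, continuous g1}.
      change {within K1, continuous (phi \o (fun x => polar (1 + x.2, x.1)))}.
      apply: (within_comp _ cphi).
        apply/continuous_subspaceT => x.
        have cp : continuous (fun x : R * R => (1 + x.2, x.1)).
          apply: continuous_pair => z; last exact: cvg_fst.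
          by apply: cvgD; [exact: cvg_cst|exact: cvg_snd].
        by apply: (continuous_comp (cp x)); exact: continuous_polar.
      by move=> x Kx; apply: D1; [left|case: Kx => _; rewrite /= in_itv/= => /andP[]].
    apply: (subspace_eq_continuous _ cg1) => x; rewrite inE => -[_ /=].
    by rewrite in_itv/= /g /from_subspace => /andP[_ ->].
  have cg2 : {within K2, continuous g2}.
    have ctau1 : {within K2, continuous (tau \o fst)}.
      apply: (within_comp _ ctau) => [|x []//].
      by apply: continuous_subspaceT => x; exact: cvg_fst.
    have cp : {within K2, continuous (fun x => (1 - x.2, tau x.1))}.
      apply: continuous_pair; last exact: ctau1.
      apply: continuous_subspaceT => x.
      by apply: cvgB; [exact: cvg_cst|exact: cvg_snd].
    have cpp : {within K2, continuous (fun x => polar (1 - x.2, tau x.1))}.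
      change {within K2, continuous (@polar R \o (fun x => (1 - x.2, tau x.1)))}.
      apply: (within_comp (B := setT) cp) => //.
      exact/continuous_subspaceT/continuous_polar.
    change {within K2, continuous (phi' \o (fun x => polar (1 - x.2, tau x.1)))}.
    apply: (within_comp cpp cphi') => x Kx.
    by apply: D2; [right|case: Kx => _; rewrite /= in_itv/= => /andP[]].
  apply: (subspace_eq_continuous _ cg2) => x; rewrite inE => -[/= x1].
  rewrite /g /from_subspace; rewrite !in_itv/= in x1 * => /andP[x2 _].
  have [x0|//] := leP x.2 0; rewrite g12//.
  by apply/eqP; rewrite eq_le x0 x2.
have arc1 s s' : l <= s <= r -> l <= s' <= r -> circle_point s = circle_point s' ->
    s = s'.
  by move=> sl sl' E; apply: (arc_inj rl phiI); rewrite ?in_itv//= E.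
have arc2 s s' : l' <= s <= r' -> l' <= s' <= r' -> circle_point s = circle_point s' ->
    s = s'.
  by move=> sl sl' E; apply: (arc_inj rl' phiI'); rewrite ?in_itv//= E.
(* The discs meet only in points of their circles, whereas [g2 y] comes from a radius below [1]. *)
have g12_neq x y : K x -> K y -> x.2 <= 0 -> 0 < y.2 -> g1 x <> g2 y.
  move=> Kx Ky x0 y0 /meet[||_]; [exact: D1|by apply: D2 => //; exact: ltW|].
  by move: Ky => /KP[_ /andP[_ y1]]; rewrite polar_norm /=; nra.
have gI x y : K x -> K y -> g x = g y -> x = y.
  move=> Kx Ky; rewrite /g; have [xlr x2] := (KP x).1 Kx.
  have [ylr y2] := (KP y).1 Ky; case/andP: x2 y2 => x2 x2' /andP[y2 y2'].
  have [x0|x0] := leP x.2 0; have [y0|y0] := leP y.2 0.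
  - move=> /(phiI (D1 x Kx x0) (D1 y Ky y0))/polar_inj[||/addrI E /(arc1 _ _ xlr ylr)].
    + lra.
    + lra.
    + by case: x y E {Kx Ky xlr ylr x2 x2' y2 y2' x0 y0} => [? ?] [? ?] /= -> ->.
  - by move=> /g12_neq; case.
  - by move=> /esym/g12_neq; case.
  - move=> /(phiI' (D2 x Kx (ltW x0)) (D2 y Ky (ltW y0)))/polar_inj[||E].
    + lra.
    + lra.
    have [tx ax] := tauP _ xlr; have [ty ay] := tauP _ ylr.
    move=> /(arc2 _ _ tx ty) t_eq.
    have xy1 : x.1 = y.1 by apply: (arc_inj rl phiI); rewrite ?in_itv// -ax -ay t_eq.
    have xy2 : x.2 = y.2 by lra.
    by rewrite [x]surjective_pairing xy1 xy2 -surjective_pairing.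
have WK : W `<=` K.
  move=> x [/=]; rewrite !in_itv/= => /andP[? ?] /andP[? ?].
  by apply/KP; split; rewrite !ltW.
have oW : open W.
  have -> : W = fst @^-1` `]l, r[%classic `&` snd @^-1` `]- 2^-1, 2^-1[%classic by [].
  apply: openI; apply: open_comp; try exact: itv_open.
    by move=> x _; exact: cvg_fst.
  by move=> x _; exact: cvg_snd.
apply: (chart_of_embedding hT cK oW WK cg gI); last first.
  exists (t, 0); last by rewrite /g /g1 /= lexx addr0 polar1.
  split; rewrite /= in_itv//=; apply/andP; split; lra.
pose C := phi @` cosector l r `|` phi' @` cosector l' r' `|` Z.
have clC : closed C.
  apply: closedU => //; apply: closedU; apply: compact_closed => //;
  apply: continuous_compact; try exact: compact_cosector;
  by apply: continuous_subspaceW (@cosector_closed_disc _ _ _) _.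
rewrite -closedC.
suff -> : ~` (g @` W) = C by [].
(* Converse of [tau_oo]: endpoints go to endpoints. *)
have tau_lr_oo s : l <= s <= r -> l' < tau s < r' -> l < s < r.
  move=> /andP[ls sr] /andP[t1 t2]; rewrite !lt_neqAle ls sr !andbT.
  apply/andP; split; apply: contraTneq isT => E; move: t1 t2.
    by rewrite -E; case: tau_lr => -[-> _]; rewrite ltxx.
  by rewrite E; case: tau_lr => -[_ ->]; rewrite ltxx.
apply/seteqP; split=> [x nx|z Cx [[s y] [/= + +] E]].
  have [] := cover x.
  - move=> [p /(sector_or_cosector rl)[[u [s [/andP[u0 u1] slr ->]]]|pC] pE]; last first.
      by left; left; exists p.
    exfalso; apply: nx; exists (s, u - 1).
      by split; rewrite /= in_itv//=; apply/andP; split; lra.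
    by rewrite /g /g1 /= subr_le0 u1 addrC subrK.
  - move=> [p /(sector_or_cosector rl')[[u [s' [/andP[u0 u1] slr ->]]]|pC] pE]; last first.
      by left; right; exists p.
    have [s s_lr sE] : exists2 s, l <= s <= r & tau s = s'.
      by apply: tauS; case/andP: slr => ? ?; rewrite !ltW.
    exfalso; apply: nx; exists (s, 1 - u).
      split; rewrite /= in_itv//=; first by apply: tau_lr_oo; rewrite ?sE.
      by apply/andP; split; lra.
    have gE : g2 (s, 1 - u) = x by rewrite /g2 /= subKr sE.
    rewrite /g /=; case: leP => // u_le; rewrite g12//=; lra.
  - by right.
rewrite !in_itv/= => slr /andP[y1 y2].
have sy : l <= s <= r by case/andP: slr => ? ?; rewrite !ltW.
have Ksy : K (s, y) by apply/KP; split=> //=; rewrite !ltW.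
have stau := tau_oo _ slr.
have sec' : sector l' r' (polar (1, tau s)).
  by exists 1, (tau s); split=> //; apply/andP; split; lra.
move: E Cx; rewrite /g /=; case: leP => y0 <-.
  have Dsy := D1 _ Ksy y0.
  have sec : sector l r (polar (1 + y, s)).
    by exists (1 + y), s; split=> //; apply/andP; split; lra.
  move=> [[[p pC /(phiI (cosector_closed_disc pC) Dsy) pE]|[q qC qE]]|].
  - by apply: (sector_cosector rl sec); rewrite -pE.
  (* A point of both discs has [y = 0]; seen from the second disc it lies in the open sector, so
     outside the cosector. *)
  - have Dq := cosector_closed_disc qC.
    have [+ _] := meet Dsy Dq (esym qE); rewrite polar_norm /= => y12.
    have y_0 : y = 0 by nra.
    have Ds : closed_disc (polar (1, tau s)).
      by apply: closed_disc_polar; rewrite ler01 lexx.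
    rewrite y_0 g12//= /g2 /= subr0 in qE.
    by apply: (sector_cosector rl' sec'); rewrite -(phiI' Dq Ds qE).
  (* [Zphi] covers the open disc only; for [y = 0] the point is also in the second disc, all of
     which avoids [Z]. *)
  - have [y_0|yn0] := eqVneq y 0.
      rewrite y_0 g12// /g2 /= subr0; apply: Zphi'.
      by apply: closed_disc_polar; rewrite ler01 lexx.
    apply: Zphi; rewrite polar_norm /=.
    have : y < 0 by rewrite lt_neqAle yn0.
    nra.
have Dsy := D2 _ Ksy (ltW y0).
move=> [[[p pC]|[q qC /(phiI' (cosector_closed_disc qC) Dsy) qE]]|].
- move=> /(meet (cosector_closed_disc pC) Dsy)[_].
  by rewrite polar_norm /=; nra.
- apply: (sector_cosector (l := l') (r := r') rl' _ qC); rewrite qE.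
  by exists (1 - y), (tau s); split=> //; apply/andP; split; lra.
- exact: Zphi'.
Qed.

End Gluing.

(** * Free arcs of a disc *)

(** The endpoints are limits of points of the open segment. *)
Lemma closed_segment_sub (R : realType) (u v : R) (V : set R) : u < v -> closed V ->
  `]u, v[ `<=` V -> `[u, v] `<=` V.
Proof.
move=> uv clV sub t; rewrite /= in_itv/= => /andP[ut tv]; apply: clV => B.
move=> /nbhs_ballP[e /= e0 eB].
pose d := Num.min e (v - u) / 2.
have m0 : 0 < Num.min e (v - u) by rewrite lt_min e0 subr_gt0.
have me : Num.min e (v - u) <= e by rewrite ge_min lexx.
have mv : Num.min e (v - u) <= v - u by rewrite ge_min lexx orbT.
have [d0 de dv] : [/\ 0 < d, d < e & d < v - u] by rewrite /d; split; lra.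
have [tu|tu] := eqVneq t u.
  exists (t + d); split; first by apply: sub; rewrite /= in_itv/=; lra.
  by apply: eB; rewrite /ball /= opprD addNKr normrN gtr0_norm.
have ut' : u < t by rewrite lt_neqAle eq_sym tu.
have [tv'|tv'] := eqVneq t v.
  exists (t - d); split; first by apply: sub; rewrite /= in_itv/=; lra.
  by apply: eB; rewrite /ball /= opprB addrC subrK gtr0_norm.
have vt : t < v by rewrite lt_neqAle tv'.
by exists t; split; [apply: sub; rewrite /= in_itv/= ut'|apply: eB; exact: ballxx].
Qed.

Section MarkedDisc.
Variables (R : realType) (T : topologicalType).
Hypothesis hT : hausdorff_space T.

(** The relation of lying on a common face. It implies that both points are boundary points, as the
    component of any other point is empty. *)
Definition joined (x y : T) : Prop :=
  connected_component (surface_boundary R T) x y.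

Lemma joined_sym x y : joined x y -> joined y x.
Proof. exact: connected_component_sym. Qed.

Lemma joined_trans y x z : joined x y -> joined y z -> joined x z.
Proof. exact: connected_component_trans. Qed.

Lemma joined_refl x : surface_boundary R T x -> joined x x.
Proof. exact: connected_component_refl. Qed.

Lemma joined_boundary x y : joined x y -> surface_boundary R T y.
Proof. exact: connected_component_sub. Qed.

Variables (phi : R * R -> T) (Z : set T).
Hypothesis cphi : {within @closed_disc R, continuous phi}.
Hypothesis phiI : forall p q, @closed_disc R p -> @closed_disc R q ->
  phi p = phi q -> p = q.
Hypothesis clZ : closed Z.
Hypothesis cover : forall x, (phi @` @closed_disc R) x \/ Z x.

(** The open arc lies in the boundary by [disc_circle_boundary]. The boundary is closed, so it
    contains the endpoints too, and the closed arc is connected. The endpoints matter: they are the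
    corners. *)
Lemma free_arc_joined u v t s : u < v ->
  (forall t, u < t < v -> ~ Z (phi (circle_point t))) ->
  u <= t <= v -> u <= s <= v ->
  joined (phi (circle_point t)) (phi (circle_point s)).
Proof.
move=> uv nZ tuv suv; pose f := phi \o @circle_point R.
have cf : {within `[u, v], continuous f} by exact: arc_continuous.
have fB : f @` `[u, v] `<=` surface_boundary R T.
  have fo x : u < x < v -> surface_boundary R T (f x).
    by move=> xuv; apply: (disc_circle_boundary hT cphi phiI clZ cover);
      [exact: cos2Dsin2|exact: nZ].
  have cl : closed ((f : subspace `[u, v]%classic -> T) @^-1` surface_boundary R T).
    by move/continuous_closedP: cf; apply; exact: closed_surface_boundary.
  have /closed_subspaceP[V clV VE] := cl.
  have uvV : `[u, v] `<=` V.
    apply: closed_segment_sub => // x; rewrite /= in_itv/= => xuv.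
    have : (V `&` `[u, v]) x.
      rewrite VE; split; first exact: fo.
      by rewrite /= in_itv/=; case/andP: xuv => ? ?; rewrite !ltW.
    by case.
  move=> _ [x xuv <-].
  have : (V `&` `[u, v]) x by split=> //; exact: uvV.
  by rewrite VE => -[].
apply: (connected_component_max _ fB).
- by exists t => //; rewrite /= in_itv.
- by apply: connected_continuous_connected => //;
    exact/connected_intervalP/interval_is_interval.
- by exists s => //; rewrite /= in_itv.
Qed.

Variables (n : nat) (l r : nat -> R).
Hypothesis n0 : (0 < n)%N.
Hypothesis lr : forall k, (k < n)%N -> l k < r k.
Hypothesis rl : forall k, (k.+1 < n)%N -> r k < l k.+1.
Hypothesis rl0 : r n.-1 < l 0 + 2 * pi.

(** After the last arc the angle runs on past a full turn, so that every gap is an increasing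
    interval. *)
Definition next_start k := if (k.+1 < n)%N then l k.+1 else l 0 + 2 * pi.

Lemma next_start_gt k : (k < n)%N -> r k < next_start k.
Proof.
rewrite /next_start => kn; case: ltnP => kn1; first exact: rl.
by have -> : k = n.-1 by apply/eqP; rewrite eqn_leq -ltnS prednK// kn; case: (n) kn1.
Qed.

Lemma start_mono j k : (j <= k)%N -> (k < n)%N -> l j <= l k.
Proof.
elim: k => [|k IH]; first by rewrite leqn0 => /eqP ->.
rewrite leq_eqVlt => /orP[/eqP ->//|]; rewrite ltnS => jk kn.
apply: le_trans (IH jk (ltnW kn)) _; apply: ltW.
exact: lt_trans (lr (ltnW kn)) (rl kn).
Qed.

Lemma end_lt_start j k : (j < k)%N -> (k < n)%N -> r j < l k.
Proof.
move=> jk kn; have jn : (j.+1 < n)%N by exact: leq_ltn_trans kn.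
exact: lt_le_trans (rl jn) (start_mono jk kn).
Qed.

Lemma end_mono j k : (j <= k)%N -> (k < n)%N -> r j <= r k.
Proof.
rewrite leq_eqVlt => /orP[/eqP ->//|jk kn].
by apply: ltW; apply: lt_trans (end_lt_start jk kn) (lr kn).
Qed.

Lemma next_start_le k : (k < n)%N -> next_start k <= l 0 + 2 * pi.
Proof.
rewrite /next_start => kn; case: ltnP => // kn1; apply: ltW; apply: lt_trans rl0.
apply: lt_le_trans (lr kn1) _; apply: end_mono; last by rewrite prednK.
by rewrite -ltnS prednK.
Qed.

Lemma arc_or_gap t : l 0 <= t < l 0 + 2 * pi ->
  exists2 k, (k < n)%N & (l k <= t <= r k) \/ (r k < t < next_start k).
Proof.
move=> /andP[t0 t1].
have H m : (m < n)%N -> t < next_start m ->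
    exists2 k, (k < n)%N & (l k <= t <= r k) \/ (r k < t < next_start k).
  elim: m => [|m IH] mn tm.
    exists 0%N => //; have [tr|tr] := leP t (r 0%N); first by left; rewrite t0.
    by right.
  have [tr|tr] := leP t (r m.+1); last by exists m.+1 => //; right; rewrite tr.
  have [lt|lt] := leP (l m.+1) t; first by exists m.+1 => //; left; rewrite lt.
  by apply: IH; [exact: ltnW|rewrite /next_start mn].
apply: (H n.-1); first by rewrite prednK.
by rewrite /next_start prednK// ltnn.
Qed.

Hypothesis ZE : forall p, closed_disc p -> Z (phi p) ->
  exists2 k, (k < n)%N & exists2 t, l k <= t <= r k & p = circle_point t.

(** A point of [Z] has an angle [s] on some marked arc. Both [s] and [t] lie in the turn starting at
    [l 0], so they coincide, against the order of arcs and gaps. *)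
Lemma gap_free k t : (k < n)%N -> r k < t < next_start k ->
  ~ Z (phi (circle_point t)).
Proof.
move=> kn /andP[t1 t2] /(ZE (closed_disc_circle t))[j jn [s /andP[s1 s2] E]].
have s0 : l 0 <= s by apply: le_trans s1; exact: start_mono.
have s3 : s < l 0 + 2 * pi.
  apply: le_lt_trans s2 _; apply: lt_le_trans (next_start_le jn); exact: next_start_gt.
have t0 : l 0 <= t.
  apply: le_trans (ltW t1); apply: le_trans (ltW (lr kn)); exact: start_mono.
have t3 : t < l 0 + 2 * pi by apply: lt_le_trans t2 (next_start_le kn).
have ts : t = s.
  have [ts|st] := leP t s; first by apply: circle_point_inj; rewrite // ts; lra.
  by apply/esym; apply: circle_point_inj; rewrite // (ltW st)/=; lra.
have [jk|kj] := leqP j k.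
  by have := end_mono jk kn; lra.
have : next_start k <= l j.
  rewrite /next_start; have -> : (k.+1 < n)%N by exact: leq_ltn_trans jn.
  exact: start_mono.
lra.
Qed.

Lemma gap_joined k t s : (k < n)%N -> r k <= t <= next_start k ->
  r k <= s <= next_start k -> joined (phi (circle_point t)) (phi (circle_point s)).
Proof.
move=> kn; apply: free_arc_joined; first exact: next_start_gt.
by move=> u; exact: gap_free.
Qed.

Lemma end_joined_start k : (k < n)%N ->
  joined (phi (circle_point (r k)))
         (phi (circle_point (l (if (k.+1 < n)%N then k.+1 else 0%N)))).
Proof.
move=> kn; have -> : circle_point (l (if (k.+1 < n)%N then k.+1 else 0%N)) =
    circle_point (next_start k).
  rewrite /next_start; case: ifP => // _.
  by have := circle_pointDn (l 0) 1; rewrite mulr1n.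
by have h := ltW (next_start_gt kn); apply: (gap_joined kn); rewrite lexx h.
Qed.

(** Points of the open disc have planar charts, so [p] is on the circle: either on a marked arc or
    in a gap, whose closure contains the corner at [r k]. *)
Lemma boundary_on_disc p : closed_disc p -> surface_boundary R T (phi p) ->
  exists2 k, (k < n)%N & (exists2 t, l k <= t <= r k & p = circle_point t) \/
                         joined (phi p) (phi (circle_point (r k))).
Proof.
move=> Dp Bp; have p1 : p.1 ^+ 2 + p.2 ^+ 2 = 1.
  apply/eqP; rewrite eq_le Dp/= leNgt; apply/negP => p_lt; apply: Bp.
  apply: (open_disc_interior hT cphi phiI clZ cover) => // q q_lt /ZE[|k _ [t _ qE]].
    exact: ltW.
  by move: q_lt; rewrite qE cos2Dsin2 ltxx.
have [t tl tE] := circle_point_surj (l 0) p1.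
have [k kn [tlr|/andP[t1 t2]]] := arc_or_gap tl; exists k => //; first by left; exists t.
right; rewrite -tE; have h := ltW (next_start_gt kn).
by apply: (gap_joined kn); rewrite ?lexx ?h// !ltW.
Qed.

End MarkedDisc.

(** * Ribbon graphs with one vertex *)

Lemma circle_arc_shift (R : realType) (l r u : R) :
  circle_point u = circle_point l -> circle_arc u (u + (r - l)) = circle_arc l r.
Proof.
move=> [uc us]; have E x : circle_point (u + x) = circle_point (l + x).
  by rewrite /circle_point !cosD !sinD uc us.
apply/seteqP; split=> _ [t /= /andP[t1 t2] <-].
  exists (l + (t - u)); first by rewrite /=; lra.
  by rewrite -E; congr circle_point; lra.
exists (u + (t - l)); first by rewrite /=; lra.
by rewrite E; congr circle_point; lra.
Qed.

(** The start of the second arc is moved into the turn beginning at [l1]. It lies beyond [r1], and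
    the arc stops before [l1 + 2 * pi], since otherwise the arcs would share a point. *)
Lemma disjoint_arcs (R : realType) (l1 r1 l2 r2 : R) : l1 < r1 -> l2 < r2 ->
  circle_arc l1 r1 `&` circle_arc l2 r2 = set0 ->
  exists u v, [/\ u < v, r1 < u, v < l1 + 2 * pi &
                  circle_arc u v = circle_arc l2 r2].
Proof.
move=> lr1 lr2 dis.
have [u /andP[u1 u2] uE] := circle_point_surj l1 (cos2Dsin2 l2 : (circle_point l2).1 ^+ 2 + (circle_point l2).2 ^+ 2 = 1).
exists u, (u + (r2 - l2)).
have arcE := circle_arc_shift r2 uE.
have nd p : circle_arc l1 r1 p -> circle_arc l2 r2 p -> False.
  by move=> p1 p2; rewrite -[False]/(set0 p) -dis.
split=> //.
- lra.
- rewrite ltNge; apply/negP => ur; apply: (nd (circle_point u)).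
    by exists u => //=; rewrite u1.
  by rewrite uE; exists l2 => //=; rewrite lexx ltW.
- rewrite ltNge; apply/negP => ur; apply: (nd (circle_point l1)).
    by exists l1 => //=; rewrite lexx ltW.
  rewrite -arcE; exists (l1 + 2 * pi); first by rewrite /=; lra.
  by have := circle_pointDn l1 1; rewrite mulr1n.
Qed.

Section RibbonGraph.
Variables (R : realType) (G : ribbon_graph R).

Lemma surf_hausdorff : hausdorff_space (surf G).
Proof. by case: (surfP G). Qed.

Lemma vmap_continuous (v : verts G) : {within @closed_disc R, continuous (vmap v)}.
Proof. by case: (vmapP v). Qed.

Lemma emap_continuous (e : edges G) : {within @closed_disc R, continuous (emap e)}.
Proof. by case: (emapP e). Qed.

Lemma vmap_inj (v : verts G) p q : closed_disc p -> closed_disc q ->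
  vmap v p = vmap v q -> p = q.
Proof. by case: (vmapP v) => /set_bij_inj vI _ _ Dp Dq; apply: vI; rewrite inE. Qed.

Lemma emap_inj (e : edges G) p q : closed_disc p -> closed_disc q ->
  emap e p = emap e q -> p = q.
Proof. by case: (emapP e) => /set_bij_inj eI _ _ Dp Dq; apply: eI; rewrite inE. Qed.

Lemma vdisc_closed (v : verts G) : closed (vdisc v).
Proof.
apply: compact_closed; first exact: surf_hausdorff.
by apply: continuous_compact; [exact: vmap_continuous|exact: compact_closed_disc].
Qed.

Lemma edisc_closed (e : edges G) : closed (edisc e).
Proof.
apply: compact_closed; first exact: surf_hausdorff.
by apply: continuous_compact; [exact: emap_continuous|exact: compact_closed_disc].
Qed.

Lemma edisc_eq (e e' : edges G) x : edisc e x -> edisc e' x -> e = e'.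
Proof. by move=> ex e'x; apply: (@edisc_disjoint R G) => //; exists x. Qed.

Lemma seg_eq (s t : segs G) x : seg s x -> seg t x -> s = t.
Proof. by move=> sx tx; apply: (@seg_disjoint R G) => //; exists x. Qed.

Lemma edge_segs (e : edges G) (s t u : segs G) : sedge s = e -> sedge t = e ->
  s != t -> sedge u = e -> u = s \/ u = t.
Proof.
move=> se te st ue.
have E : [set s; t]%SET = [set u | sedge u == e]%SET.
  apply/eqP; rewrite eqEcard two_segs cards2 st andbT.
  by apply/fintype.subsetP => x /set2P[] ->; rewrite inE ?se ?te.
have : u \in [set s; t]%SET by rewrite E inE ue.
by move/set2P.
Qed.

Variable v : verts G.
Hypothesis one_vert : forall v', v' = v.

Definition other_edges (e : edges G) : set (surf G) :=
  \bigcup_(e' in [set e' | e' <> e]) edisc e'.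

Lemma other_edges_closed e : closed (other_edges e).
Proof. by apply: closed_bigcup => [|e' _]; [exact: finite_finset|exact: edisc_closed]. Qed.

Lemma edges_closed : closed (\bigcup_e edisc e : set (surf G)).
Proof. by apply: closed_bigcup => [|e' _]; [exact: finite_finset|exact: edisc_closed]. Qed.

Lemma surf_cover (x : surf G) : vdisc v x \/ exists e, edisc e x.
Proof.
have : [set: surf G] x by [].
rewrite -discs_cover => -[[v' _ vx]|[e _ ex]]; last by right; exists e.
by left; rewrite -(one_vert v').
Qed.

Lemma vdisc_edisc (e : edges G) x : vdisc v x -> edisc e x -> exists2 s, sedge s = e & seg s x.
Proof.
move=> vx ex; have : (vdisc v `&` edisc e) x by [].
by rewrite vdiscI_edisc => -[s [_ se] sx]; exists s.
Qed.

Lemma seg_vdisc (s : segs G) : seg s `<=` vdisc v.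
Proof.
have [l [r [_ _ ->]]] := seg_on_vert s; rewrite (one_vert (svert s)).
by move=> _ [_ [t _ <-] <-]; exists (circle_point t) => //; exact: closed_disc_circle.
Qed.

Lemma vmap_emap_meet (e : edges G) p q : closed_disc p -> closed_disc q ->
  vmap v p = emap e q -> p.1 ^+ 2 + p.2 ^+ 2 = 1 /\ q.1 ^+ 2 + q.2 ^+ 2 = 1.
Proof.
move=> Dp Dq pq.
have [] := @vdisc_edisc e (vmap v p); [by exists p|by exists q|].
move=> s se sx; split.
  have [l [r [_ _ E]]] := seg_on_vert s; move: sx.
  rewrite E (one_vert (svert s)) => -[_ [t _ <-] /vmap_inj <-//].
    exact: cos2Dsin2.
  exact: closed_disc_circle.
have [l [r [_ _ E]]] := seg_on_edge s; move: sx.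
rewrite E se pq => -[_ [t _ <-] /emap_inj <-//].
  exact: cos2Dsin2.
exact: closed_disc_circle.
Qed.

(** Puts the two ends of an edge in the cyclic form required of a marked disc, here with two
    arcs. *)
Lemma edge_arcs (e : edges G) (s t : segs G) : sedge s = e -> sedge t = e -> s != t ->
  exists l r : nat -> R,
  [/\ forall k, (k < 2)%N -> l k < r k,
      forall k, (k.+1 < 2)%N -> r k < l k.+1,
      r 1%N < l 0%N + 2 * pi,
      seg s = emap e @` circle_arc (l 0%N) (r 0%N) &
      seg t = emap e @` circle_arc (l 1%N) (r 1%N)].
Proof.
move=> se te st.
have [l1 [r1 [lr1 _ sE]]] := seg_on_edge s; have [l2 [r2 [lr2 _ tE]]] := seg_on_edge t.
rewrite se in sE; rewrite te in tE.
have [u [v' [uv r1u vl1 arcE]]] : exists u v, [/\ u < v, r1 < u, v < l1 + 2 * pi &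
    circle_arc u v = circle_arc l2 r2].
  apply: disjoint_arcs => //; apply/seteqP; split=> // p [p1 p2].
  move: st; rewrite (@seg_eq s t (emap e p)) ?eqxx//.
    by rewrite sE; exists p.
  by rewrite tE; exists p.
exists (fun k => if k is 0 then l1 else u), (fun k => if k is 0 then r1 else v').
by split=> //; [case=> // -[]|case|rewrite arcE].
Qed.

(** * The two sides of an edge *)

Section EdgeSides.
Variables (e : edges G) (s t : segs G) (l r : nat -> R).
Hypotheses (se : sedge s = e) (te : sedge t = e) (st : s != t).
Hypothesis lr : forall k, (k < 2)%N -> l k < r k.
Hypothesis rl : forall k, (k.+1 < 2)%N -> r k < l k.+1.
Hypothesis rl0 : r 1%N < l 0%N + 2 * pi.
Hypothesis sE : seg s = emap e @` circle_arc (l 0%N) (r 0%N).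
Hypothesis tE : seg t = emap e @` circle_arc (l 1%N) (r 1%N).

Let Z : set (surf G) := vdisc v `|` other_edges e.

Let clZ : closed Z.
Proof. by apply: closedU; [exact: vdisc_closed|exact: other_edges_closed]. Qed.

Let cover x : (emap e @` @closed_disc R) x \/ Z x.
Proof.
have [vx|[e' ex]] := surf_cover x; first by right; left.
by have [ee'|ne] := pselect (e' = e); [left; rewrite -ee'|right; right; exists e'].
Qed.

Let ZE p : closed_disc p -> Z (emap e p) ->
  exists2 k, (k < 2)%N & exists2 t, l k <= t <= r k & p = circle_point t.
Proof.
move=> Dp [vx|[e' ne ex]]; last first.
  by exfalso; apply: ne; apply: (edisc_eq ex); exists p.
have [|s' s'e s'x] := @vdisc_edisc e (emap e p) vx; first by exists p.
have [ss|ss] := edge_segs se te st s'e; move: s'x; rewrite ss ?sE ?tE.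
  move=> [_ [x xlr <-] /emap_inj <-//]; last exact: closed_disc_circle.
  by exists 0%N => //; exists x.
move=> [_ [x xlr <-] /emap_inj <-//]; last exact: closed_disc_circle.
by exists 1%N => //; exists x.
Qed.

(** The sides of the edge are the two gaps between the marked arcs of its disc. *)
Lemma edge_sides_joined :
  joined R (emap e (circle_point (r 0%N))) (emap e (circle_point (l 1%N))) /\
  joined R (emap e (circle_point (r 1%N))) (emap e (circle_point (l 0%N))).
Proof.
have H := end_joined_start surf_hausdorff (@emap_continuous e) (@emap_inj e) clZ cover
  (isT : (0 < 2)%N) lr rl rl0 ZE.
by split; [exact: (H 0%N)|exact: (H 1%N)].
Qed.

Lemma edge_boundary x : edisc e x -> surface_boundary R (surf G) x ->
  [\/ vdisc v x, joined R x (emap e (circle_point (r 0%N))) |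
      joined R x (emap e (circle_point (r 1%N)))].
Proof.
move=> [p Dp <-] /(boundary_on_disc surf_hausdorff (@emap_continuous e) (@emap_inj e)
  clZ cover (isT : (0 < 2)%N) lr rl rl0 ZE Dp)[k k2 [[u ulr ->]|]]; last first.
  by case: k k2 => [|[|//]] _ J; [constructor 2|constructor 3].
constructor 1; case: k k2 ulr => [|[|//]] _ ulr.
  by apply: (@seg_vdisc s); rewrite sE; exists (circle_point u) => //; exists u.
by apply: (@seg_vdisc t); rewrite tE; exists (circle_point u) => //; exists u.
Qed.

End EdgeSides.

(** * Corners around the vertex *)

Section Vertex.
Variables (w : seq (segs G)) (s0 : segs G) (l r : nat -> R).
Hypothesis w_all : forall s, s \in w.
Hypothesis w_uniq : uniq w.
Hypothesis lr : forall k, (k < size w)%N -> l k < r k.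
Hypothesis segE : forall k, (k < size w)%N ->
  seg (nth s0 w k) = vmap v @` circle_arc (l k) (r k).
Hypothesis rl : forall k, (k.+1 < size w)%N -> r k < l k.+1.
Hypothesis rl0 : r (size w).-1 < l 0%N + 2 * pi.

Definition arc_start k : surf G := vmap v (circle_point (l k)).
Definition arc_end k : surf G := vmap v (circle_point (r k)).

Let w0 : (0 < size w)%N.
Proof. by have := w_all s0; case: (w). Qed.

Let ex_pos s : exists2 k, (k < size w)%N & nth s0 w k = s.
Proof. by exists (index s w); rewrite ?index_mem ?nth_index. Qed.

Let cover x : (vmap v @` @closed_disc R) x \/ (\bigcup_e edisc e : set (surf G)) x.
Proof. by have [|[e ex]] := surf_cover x; [left|right; exists e]. Qed.

Let ZE p : closed_disc p -> (\bigcup_e edisc e : set (surf G)) (vmap v p) ->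
  exists2 k, (k < size w)%N & exists2 t, l k <= t <= r k & p = circle_point t.
Proof.
move=> Dp [e _ ex]; have [|s se sx] := @vdisc_edisc e (vmap v p) _ ex.
  by exists p.
have [k kn ks] := ex_pos s; exists k => //; move: sx; rewrite -ks segE//.
move=> [_ [t tlr <-] /vmap_inj <-//]; last exact: closed_disc_circle.
by exists t.
Qed.

Lemma arc_end_joined k : (k < size w)%N ->
  joined R (arc_end k) (arc_start (if (k.+1 < size w)%N then k.+1 else 0%N)).
Proof.
exact: (end_joined_start surf_hausdorff (@vmap_continuous v) (@vmap_inj v)
  edges_closed cover w0 lr rl rl0 ZE).
Qed.

Let arc_width k : (k < size w)%N -> r k < l k + 2 * pi.
Proof.
move=> kn; have h1 := start_mono lr rl (leq0n k) kn.
have h2 : r k <= r (size w).-1.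
  by apply: (end_mono lr rl); [rewrite -ltnS prednK|rewrite prednK].
by move: rl0; lra.
Qed.

(** Vertex and edge parametrize the same segment, in the same or in opposite directions. *)
Lemma arc_corners k (e : edges G) l' r' : (k < size w)%N ->
  l' < r' -> r' < l' + 2 * pi ->
  seg (nth s0 w k) = emap e @` circle_arc l' r' ->
  (arc_start k = emap e (circle_point l') /\ arc_end k = emap e (circle_point r')) \/
  (arc_start k = emap e (circle_point r') /\ arc_end k = emap e (circle_point l')).
Proof.
move=> kn lr' rl' sE.
apply: (arc_endpoints surf_hausdorff (lr kn) lr'
  (arc_continuous (@vmap_continuous v)) (arc_continuous (@emap_continuous e))
  (arc_inj (arc_width kn) (@vmap_inj v)) (arc_inj rl' (@emap_inj e))).
by rewrite -!arc_image -sE segE.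
Qed.

Definition joined_corner k x := joined R x (arc_start k) \/ joined R x (arc_end k).

(** Each side of the edge links a corner of one end to a corner of the other. Directions decide
    which corners are linked, but all four cases give the same conclusion. *)
Lemma mate_corners j k : (j < size w)%N -> (k < size w)%N -> j <> k ->
  sedge (nth s0 w j) = sedge (nth s0 w k) ->
  joined_corner k (arc_start j) /\ joined_corner k (arc_end j).
Proof.
move=> jn kn jk se.
have st : nth s0 w j != nth s0 w k by rewrite nth_uniq//; exact/eqP.
have [l' [r' [lr' rl' rl0' sE tE]]] := edge_arcs se erefl st.
have [J1 J2] := edge_sides_joined se erefl st lr' rl' rl0' sE tE.
have H0 := lr' 0%N isT; have H1 := lr' 1%N isT; have H2 := rl' 0%N isT.
have {}jE := arc_corners jn H0 _ sE; have {}kE := arc_corners kn H1 _ tE.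
have {}jE := jE ltac:(lra); have {}kE := kE ltac:(lra).
rewrite /joined_corner; move/joined_sym: J2 => J2.
by case: jE kE => -[-> ->] [] [-> ->]; split; by [left|right].
Qed.

(** A boundary point lies on a free arc of the vertex or of an edge, whose closure contains a
    corner, or on a segment, where the glued chart leaves only the two corners. *)
Lemma boundary_corner x : surface_boundary R (surf G) x ->
  exists2 k, (k < size w)%N & joined_corner k x.
Proof.
move=> Bx; wlog vx : / vdisc v x.
  move=> H; have [|[e ex]] := surf_cover x; first exact: H.
  have /card_gt0P[s] : (0 < #|[set s : segs G | sedge s == e]%SET|)%N by rewrite two_segs.
  rewrite inE => /eqP se.
  have [t] : exists2 t, sedge t = e & s != t.
    have : (0 < #|[set s : segs G | sedge s == e]%SET :\ s|)%N.
      by have := cardsD1 s [set s : segs G | sedge s == e]%SET;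
        rewrite two_segs inE se eqxx add1n => -[<-].
    move=> /card_gt0P[t]; rewrite !inE => /andP[ts /eqP te].
    by exists t; rewrite // eq_sym.
  move=> te st.
  have [l' [r' [lr' rl' rl0' sE tE]]] := edge_arcs se te st.
  have H0 := lr' 0%N isT; have H1 := lr' 1%N isT; have H2 := rl' 0%N isT.
  have [/H//|J|J] := edge_boundary se te st lr' rl' rl0' sE tE ex Bx.
    have [k kn ks] := ex_pos s; exists k => //.
    rewrite -ks in sE; have := arc_corners kn H0 _ sE.
    by move=> /(_ ltac:(lra))[[_ E]|[E _]]; [right|left]; rewrite E.
  have [k kn ks] := ex_pos t; exists k => //.
  rewrite -ks in tE; have := arc_corners kn H1 _ tE.
  by move=> /(_ ltac:(lra))[[_ E]|[E _]]; [right|left]; rewrite E.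
case: vx Bx => p Dp <- Bx.
have [k kn [[t /andP[t1 t2] pE]|J]] := boundary_on_disc surf_hausdorff
    (@vmap_continuous v) (@vmap_inj v) edges_closed cover w0 lr rl rl0 ZE Dp Bx;
  exists k => //; last by right.
rewrite pE in Bx *.
have [tl|tl] := eqVneq t (l k); first by left; rewrite tl in Bx *; exact: joined_refl.
have [tr|tr] := eqVneq t (r k); first by right; rewrite tr in Bx *; exact: joined_refl.
exfalso; apply: Bx.
have [l' [r' [lr' rl' sE]]] := seg_on_edge (nth s0 w k).
rewrite segE// in sE.
apply: (segment_interior_chart surf_hausdorff (@vmap_continuous v)
  (@emap_continuous (sedge (nth s0 w k))) (@vmap_inj v) (@emap_inj _)
  (@other_edges_closed (sedge (nth s0 w k))) _ (lr kn) (arc_width kn) lr' rl' sE).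
- move=> y; have [vy|[e ey]] := surf_cover y; first by constructor 1.
  have [ee|ne] := pselect (e = sedge (nth s0 w k)).
    by constructor 2; rewrite -ee.
  by constructor 3; exists e.
- by move=> a b Da Db; exact: vmap_emap_meet.
- move=> q q1 [e ne [q' Dq' qE]].
  have [+ _] := vmap_emap_meet (ltW q1 : closed_disc q) Dq' (esym qE).
  by move: q1 => /[swap] ->; rewrite ltxx.
- move=> q Dq [e ne ex]; apply: ne; apply: (edisc_eq ex).
  by exists q.
- by rewrite !lt_neqAle t1 t2 tr eq_sym tl.
Qed.

End Vertex.

End RibbonGraph.

(** * Petal flowers *)

Section PetalWord.
Variables (S : Type) (x0 : S).
Local Open Scope nat_scope.

Lemma nth_flatten_pairs (f g : nat -> S) m q j (s : seq S) : j < q ->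
  let t := flatten [seq [:: f i; g i] | i <- iota m q] ++ s in
  nth x0 t j.*2 = f (m + j) /\ nth x0 t j.*2.+1 = g (m + j).
Proof.
elim: q m j => [//|q IH] m [|j]; first by rewrite addn0.
by rewrite ltnS => /(IH m.+1) /=; rewrite addSnnS.
Qed.

Lemma size_flatten_pairs (f g : nat -> S) m q :
  size (flatten [seq [:: f i; g i] | i <- iota m q]) = q.*2.
Proof. by elim: q m => [//|q IH] m /=; rewrite IH. Qed.

Variables (a b : nat -> S) (M : nat).
Let w := petal_word a b M.+1.

Lemma size_petal_word : size w = M.+1.*2.
Proof. by rewrite /w /petal_word /= size_cat size_flatten_pairs addn1. Qed.

(** [a 1] is at position [0], which the truncated predecessor yields for [i = 0]; the later [a]
    occupy odd positions. *)
Lemma nth_petal_word_a i : i <= M -> nth x0 w i.*2.-1 = a i.+1.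
Proof.
case: i => [//|i] iM; rewrite /w /petal_word doubleS /=.
by have [-> _] := nth_flatten_pairs (fun i => a i.+1) b 1 [:: b M.+1] iM.
Qed.

Lemma nth_petal_word_b i : i < M -> nth x0 w i.+1.*2 = b i.+1.
Proof.
move=> iM; rewrite /w /petal_word doubleS /=.
by have [_ ->] := nth_flatten_pairs (fun i => a i.+1) b 1 [:: b M.+1] iM.
Qed.

Lemma nth_petal_word_last : nth x0 w M.*2.+1 = b M.+1.
Proof. by rewrite /w /petal_word /= nth_cat size_flatten_pairs ltnn subnn. Qed.

End PetalWord.

Lemma card_set2 (T : pointedType) (x y : T) : x <> y -> ([set x; y] #= `I_2)%card.
Proof.
move=> xy; apply/card_esym/card_set_bijP.
exists (fun n => if n == 0%N then x else y); split.
- by move=> [|n] _; [left|right].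
- by move=> [|[|n]] [|[|m]]; rewrite !inE //= => _ _ E; case: xy.
- by move=> z [->|->]; [exists 0%N|exists 1%N].
Qed.

Theorem theorem1 (R : realType) (N : nat) (G : ribbon_graph R)
    (hN : (1 <= N)%N) (hG : petal_flower N G) :
  (faces G #= `I_1)%card \/ (faces G #= `I_2)%card.
Proof.
case: N hN hG => // M _ [/fintype1[v one_vert] [e [a [b [_ _ ends order]]]]].
have [w_uniq w_all [l [r [wlr rl rl0]]]] := order v.
set w := petal_word a b M.+1 in w_uniq w_all wlr rl rl0.
pose s0 := a 1%N.
have {}w_all s : s \in w by rewrite w_all (one_vert (svert s)).
have lr k : (k < size w)%N -> l k < r k by move=> /(wlr k s0)[].
have segE k : (k < size w)%N -> seg (nth s0 w k) = vmap v @` circle_arc (l k) (r k).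
  by move=> /(wlr k s0)[].
have sz : size w = M.+1.*2 by exact: size_petal_word.
pose L := arc_start v l; pose E := arc_end v r.
have gap k : (k < size w)%N ->
    joined R (E k) (L (if (k.+1 < size w)%N then k.+1 else 0%N)).
  exact: (arc_end_joined one_vert w_all lr segE rl rl0).
have mate := mate_corners one_vert w_all w_uniq lr segE rl rl0.
have corner := boundary_corner one_vert w_all lr segE rl rl0.
(* The points on the faces through the two corners of [a 1]. *)
pose P x := joined R (L 0%N) x \/ joined R (E 0%N) x.
have Ptrans x y : P x -> joined R x y -> P y.
  by move=> [] H J; [left|right]; exact: joined_trans J.
(* The last gap wraps around to position [0], so this corner ends a free arc. *)
have BL0 : surface_boundary R (surf G) (L 0%N).
  have /gap : ((size w).-1 < size w)%N by rewrite sz.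
  by rewrite prednK ?sz// ltnn => /joined_boundary.
have BE0 : surface_boundary R (surf G) (E 0%N).
  by have /gap/joined_sym/joined_boundary : (0 < size w)%N by rewrite sz.
pose good k := P (L k) /\ P (E k).
have good_mate j k : (j < size w)%N -> (k < size w)%N -> j <> k ->
    sedge (nth s0 w j) = sedge (nth s0 w k) -> good k -> good j.
  move=> jn kn jk se [gL gE]; have [hL hE] := mate j k jn kn jk se.
  by split; [case: hL|case: hE] => /joined_sym; exact: Ptrans.
(* The gaps on either side of position [k.+1] lead to its two neighbours. *)
have good_between k : (k.+2 < size w)%N -> good k -> good k.+2 -> good k.+1.
  move=> kn [_ gE] [gL _]; have kn1 := ltnW kn; split.
    by apply: Ptrans gE _; have := gap k (ltnW kn1); rewrite kn1.
  apply: Ptrans gL _; apply: joined_sym.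
  by have := gap k.+1 kn1; rewrite kn.
have ends_edge i : (i <= M)%N -> sedge (b i.+1) = sedge (a i.+1).
  by move=> iM; have [_ -> ->] := ends i.+1 iM.
(* For [i = 0] both positions are that of [a 1]. In the step, [b i.+1] at [i.+1.*2] is the mate of
   [a i.+1] at [i.*2.-1], and the position [i.*2.+1] then lies between two good ones. *)
have H i : (i <= M)%N -> good i.*2 /\ good i.*2.-1.
  elim: i => [_|i IH iM].
    by split; split; [left|right|left|right]; exact: joined_refl.
  have [g1 g2] := IH (ltnW iM).
  have n2 : (i.+1.*2 < size w)%N by rewrite sz ltn_double ltnS.
  have g3 : good i.+1.*2.
    apply: good_mate g2 => //.
    - by apply: leq_ltn_trans n2; rewrite doubleS; lia.
    - by lia.
    - by rewrite nth_petal_word_b// nth_petal_word_a ?(ltnW iM)// ends_edge// ltnW.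
  by split=> //; apply: good_between g1 g3.
have good_all k : (k < size w)%N -> good k.
  move=> kn; have [i [iM kE]] : exists i, (i <= M)%N /\ (k = i.*2 \/ k = i.*2.+1).
    exists k./2; have := odd_double_half k; move: kn; rewrite sz.
    by case: (odd k) => /= kn kE; split; lia.
  have [g1 g2] := H i iM; case: kE => -> //.
  (* The last position, that of [b M.+1], is not reached by [H]; its mate [a M.+1] is. *)
  have [->|iM'] := eqVneq i M.
    have [_ g3] := H M (leqnn M).
    apply: good_mate g3; rewrite ?sz; try lia.
    by rewrite nth_petal_word_last nth_petal_word_a// ends_edge.
  have {}iM' : (i < M)%N by rewrite ltn_neqAle iM'.
  by have [_] := H i.+1 iM'.
have PB x : surface_boundary R (surf G) x -> P x.
  move=> /corner[k kn]; have [gL gE] := good_all k kn.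
  by case=> /joined_sym; exact: Ptrans.
pose C := connected_component (surface_boundary R (surf G)).
have facesE : faces G = [set C (L 0%N); C (E 0%N)].
  apply/seteqP; split=> [_ [x /PB Px <-]|_ [->|->]].
  - by case: Px => /same_connected_component <-; [left|right].
  - by exists (L 0%N).
  - by exists (E 0%N).
rewrite facesE; have [CE|CE] := pselect (C (L 0%N) = C (E 0%N)).
  by left; rewrite CE setUid; exact: card_set1.
by right; exact: card_set2.
Qed.
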